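(* Let $A$ be a (complex) $C^*$-algebra of real rank zero, and let $E$ and $F$ be Hilbert $A$-modules with $E$ full. Let $\theta: E\to F$ be a $\mathbb{C}$-linear $A$-module map (not assumed to be bounded) that preserves orthogonality, i.e. for all $x,y\in E$, $\langle x,y\rangle = 0$ implies $\langle\theta(x),\theta(y)\rangle = 0$. Then there is $u\in Z(M(A))_+$ such that $$\langle \theta(x),\theta(y)\rangle = u\langle x,y\rangle \qquad (x,y\in E).$$ In particular, $\theta$ is automatically bounded.
   Context: Hilbert $A$-modules are right Hilbert $C^*$-modules over $A$, with $A$-valued inner product $\langle\cdot,\cdot\rangle$ that is conjugate-linear in the first variable and satisfies $\langle x, ya\rangle = \langle x,y\rangle a$. $E$ is full if the linear span of $\{\langle x,y\rangle: x,y\in E\}$ is norm dense in $A$. A map $\theta:E\to F$ is an $A$-module map if $\theta(xa)=\theta(x)a$ for all $x\in E$, $a\in A$. $A$ has real rank zero if every self-adjoint element of $A$ (of the unitization of $A$, when $A$ is not unital) can be approximated in norm by invertible self-adjoint elements. $M(A)$ is the multiplier algebra of $A$, and $Z(M(A))_+$ is the set of positive elements of its center. *)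

(* Defs.v *)
From HB Require Import structures.
From mathcomp Require Import all_boot all_order all_algebra.
From mathcomp Require Import all_classical all_reals all_analysis.
From mathcomp Require Import complex.

Set Implicit Arguments.
Unset Strict Implicit.
Unset Printing Implicit Defensive.

Import Order.TTheory GRing.Theory Num.Theory.
Import numFieldNormedType.Exports.

Local Open Scope classical_set_scope.
Local Open Scope ring_scope.
Local Open Scope complex_scope.

Declare Scope cstar_scope.
Delimit Scope cstar_scope with cstar.
Reserved Notation "a ** b" (at level 40, left associativity).

(* The scalar field is C = R[i].  Norms of a normedModType over C take their
   values in C, where they are nonnegative reals.  The algebra is not assumed
   to be unital, which is why it does not extend the ring hierarchy. *)
HB.mixin Record isCStarAlgebra (R : realType) A
    of CompleteNormedModule R[i] A := {
  cmul : A -> A -> A;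
  star : A -> A;
  cmulA : forall a b c, cmul a (cmul b c) = cmul (cmul a b) c;
  cmulDl : forall a b c, cmul (a + b) c = cmul a c + cmul b c;
  cmulDr : forall a b c, cmul a (b + c) = cmul a b + cmul a c;
  cmulZl : forall (k : R[i]) a b, cmul (k *: a) b = k *: cmul a b;
  cmulZr : forall (k : R[i]) a b, cmul a (k *: b) = k *: cmul a b;
  starD : forall a b, star (a + b) = star a + star b;
  starZ : forall (k : R[i]) a, star (k *: a) = conjc k *: star a;
  starM : forall a b, star (cmul a b) = cmul (star b) (star a);
  starK : forall a, star (star a) = a;
  cnormM : forall a b, `|cmul a b| <= `|a| * `|b|;
  cnorm_starM : forall a, `|cmul (star a) a| = `|a| ^+ 2
}.

#[short(type="cstarAlgType")]
HB.structure Definition CStarAlgebra (R : realType) :=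
  {A of CompleteNormedModule R[i] A & isCStarAlgebra R A}.

Notation "a ** b" := (cmul a b) : cstar_scope.
Local Open Scope cstar_scope.

Definition cpositive (R : realType) (A : cstarAlgType R) (a : A) : Prop :=
  exists b : A, a = star b ** b.

(* The norm of the completeNormedModType is required to be the one induced by
   the inner product, which makes the latter definite. *)
HB.mixin Record isHilbertModule (R : realType) (A : cstarAlgType R) E
    of CompleteNormedModule R[i] E := {
  ract : E -> A -> E;
  inner : E -> E -> A;
  ractDl : forall x y a, ract (x + y) a = ract x a + ract y a;
  ractDr : forall x a b, ract x (a + b) = ract x a + ract x b;
  ractZl : forall (k : R[i]) x a, ract (k *: x) a = k *: ract x a;
  ractZr : forall (k : R[i]) x a, ract x (k *: a) = k *: ract x a;
  ractM : forall x a b, ract x (a ** b) = ract (ract x a) b;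
  innerDr : forall x y z, inner x (y + z) = inner x y + inner x z;
  innerZr : forall (k : R[i]) x y, inner x (k *: y) = k *: inner x y;
  inner_ract : forall x y a, inner x (ract y a) = inner x y ** a;
  star_inner : forall x y, star (inner x y) = inner y x;
  inner_ge0 : forall x, cpositive (inner x x);
  hnormE : forall x, `|x| ^+ 2 = `|inner x x|
}.

#[short(type="hilbertModType")]
HB.structure Definition HilbertModule (R : realType) (A : cstarAlgType R) :=
  {E of CompleteNormedModule R[i] E & isHilbertModule R A E}.

Section OperatorNotions.
Variable R : realType.

Definition bounded_op (V W : normedModType R[i]) (f : V -> W) : Prop :=
  exists M : R, forall x, `|f x| <= M%:C * `|x|.

Variable A : cstarAlgType R.

Definition full (E : hilbertModType A) : Prop :=
  dense [set a : A | exists n (k : 'I_n -> R[i]) (x y : 'I_n -> E),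
    a = \sum_(i < n) k i *: inner (x i) (y i)].

Definition module_map (E F : hilbertModType A) (f : E -> F) : Prop :=
  forall x (a : A), f (ract x a) = ract (f x) a.

Definition orthogonality_preserving (E F : hilbertModType A) (f : E -> F) :
    Prop :=
  forall x y, inner x y = 0 :> A -> inner (f x) (f y) = 0 :> A.

Definition selfadjoint (a : A) : Prop := star a = a.

Definition is_unit_elt (e : A) : Prop := forall a, e ** a = a /\ a ** e = a.

Definition unital : Prop := exists e : A, is_unit_elt e.

Definition invertible (a : A) : Prop :=
  exists b e, [/\ is_unit_elt e, a ** b = e & b ** a = e].

(* The unitization: (a, k) stands for a + k 1. *)
Definition unitization : Type := (A * R[i])%type.

Definition unitz_mul (p q : unitization) : unitization :=
  (p.1 ** q.1 + p.2 *: q.1 + q.2 *: p.1, p.2 * q.2).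

Definition unitz_star (p : unitization) : unitization := (star p.1, conjc p.2).

Definition unitz_sub (p q : unitization) : unitization :=
  (p.1 - q.1, p.2 - q.2).

Definition unitz_selfadjoint (p : unitization) : Prop := unitz_star p = p.

Definition unitz_invertible (p : unitization) : Prop :=
  exists q, unitz_mul p q = (0, 1) /\ unitz_mul q p = (0, 1).

(* The operator norm of left multiplication on A.  When A is not unital this
   is the unique C*-norm of the unitization. *)
Definition unitz_norm (p : unitization) : R :=
  sup [set complex.Re `|p.1 ** c + p.2 *: c| | c in [set c : A | `|c| <= 1]].

Definition real_rank_zero : Prop :=
  (unital -> forall a : A, selfadjoint a -> forall e : R, 0 < e ->
     exists b, [/\ selfadjoint b, invertible b & `|a - b| < e%:C]) /\
  (~ unital -> forall p, unitz_selfadjoint p -> forall e : R, 0 < e ->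
     exists q, [/\ unitz_selfadjoint q, unitz_invertible q &
                   unitz_norm (unitz_sub p q) < e]).

(* The multiplier algebra M(A), as the algebra of double centralizers:
   [mleft u a] is u a and [mright u a] is a u. *)
Record multiplier : Type := Multiplier {
  mleft : A -> A;
  mright : A -> A;
  mleft_linear : linear mleft;
  mright_linear : linear mright;
  mleft_bounded : bounded_op mleft;
  mright_bounded : bounded_op mright;
  mleftM : forall a b, mleft (a ** b) = mleft a ** b;
  mrightM : forall a b, mright (a ** b) = a ** mright b;
  mleft_right : forall a b, a ** mleft b = mright a ** b
}.

Lemma multiplier_eq (u v : multiplier) :
  mleft u =1 mleft v -> mright u =1 mright v -> u = v.
Proof.
case: u v => [l r p1 p2 p3 p4 p5 p6 p7] [l' r' q1 q2 q3 q4 q5 q6 q7] /=.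
move=> /funext el /funext er; subst l' r'.
by congr Multiplier; exact: Prop_irrelevance.
Qed.

Lemma linear_comp (f g : A -> A) : linear f -> linear g -> linear (f \o g).
Proof. by move=> lf lg k a b /=; rewrite lg lf. Qed.

Lemma bounded_op_comp (f g : A -> A) :
  bounded_op f -> bounded_op g -> bounded_op (f \o g).
Proof.
move=> [M fM] [N gN]; exists (`|M| * N) => a /=.
have fM' b : `|f b| <= `|M|%:C * `|b|.
  by apply: (le_trans (fM b)); rewrite ler_wpM2r// lecR ler_norm.
apply: (le_trans (fM' _)); rewrite rmorphM /= -mulrA.
by rewrite ler_wpM2l// lecR.
Qed.

Lemma linear_star (f : A -> A) :
  linear f -> linear (fun a => star (f (star a))).
Proof. by move=> lf k a b; rewrite starD starZ lf starD starZ conjcK. Qed.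

Lemma cnorm_star (a : A) : `|star a| = `|a|.
Proof.
have le_star (b : A) : `|b| <= `|star b|.
  have [->|b0] := eqVneq b 0; first by rewrite normr0.
  rewrite -(ler_pM2r (x := `|b|)) ?normr_gt0// -expr2 -cnorm_starM.
  exact: cnormM.
by apply/eqP; rewrite eq_le le_star andbT -{2}(starK a) le_star.
Qed.

Lemma bounded_op_star (f : A -> A) :
  bounded_op f -> bounded_op (fun a => star (f (star a))).
Proof. by move=> [M fM]; exists M => a; rewrite cnorm_star -(cnorm_star a). Qed.

Program Definition mult_mul (u v : multiplier) : multiplier :=
  @Multiplier (mleft u \o mleft v) (mright v \o mright u) _ _ _ _ _ _ _.
Next Obligation. by move=> u v; apply: linear_comp; exact: mleft_linear. Qed.
Next Obligation. by move=> u v; apply: linear_comp; exact: mright_linear. Qed.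
Next Obligation.
by move=> u v; apply: bounded_op_comp; exact: mleft_bounded.
Qed.
Next Obligation.
by move=> u v; apply: bounded_op_comp; exact: mright_bounded.
Qed.
Next Obligation. by move=> u v a b /=; rewrite !mleftM. Qed.
Next Obligation. by move=> u v a b /=; rewrite !mrightM. Qed.
Next Obligation. by move=> u v a b /=; rewrite !mleft_right. Qed.

(* u^* a = (a^* u)^* and a u^* = (u a^* )^* *)
Program Definition mult_star (u : multiplier) : multiplier :=
  @Multiplier (fun a => star (mright u (star a)))
              (fun a => star (mleft u (star a))) _ _ _ _ _ _ _.
Next Obligation. by move=> u; apply: linear_star; exact: mright_linear. Qed.
Next Obligation. by move=> u; apply: linear_star; exact: mleft_linear. Qed.
Next Obligation.
by move=> u; apply: bounded_op_star; exact: mright_bounded.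
Qed.
Next Obligation. by move=> u; apply: bounded_op_star; exact: mleft_bounded. Qed.
Next Obligation. by move=> u a b /=; rewrite starM mrightM starM starK. Qed.
Next Obligation. by move=> u a b /=; rewrite starM mleftM starM starK. Qed.
Next Obligation.
move=> u a b /=.
by rewrite -{1}(starK a) -starM -mleft_right starM starK.
Qed.

Definition mult_central (u : multiplier) : Prop :=
  forall v, mult_mul u v = mult_mul v u.

Definition mult_positive (u : multiplier) : Prop :=
  exists v, u = mult_mul (mult_star v) v.

End OperatorNotions.

Arguments unital {R} A.
Arguments real_rank_zero {R} A.
Arguments full {R A} E.

(* Main.v *)
(* Put phi x y = <theta x, theta y>.  If p = <z, z> is a projection, then
   y - z <z, y> is orthogonal to z, so phi z y = d <z, y> with d = phi z z in
   p A p, and a p b = 0 implies a d b = 0.  Thus d commutes with the projections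
   of p A p, hence with p A p by real rank zero.  A pair of orthogonal vectors
   built from two such vectors z, w relates the corresponding elements d and
   yields phi x y <z, w> = <x, y> phi z w for all x and w of the form z a; these
   are dense in E, because spectral projections of approximations of <x, x> - t
   by invertible elements lie in A.  The uniform boundedness principle bounds
   theta on the dense subspace of those x for which phi x is bounded, and
   orthogonality forces theta to agree with the bounded extension.  Then u is
   determined by (u a) <x, y> = a phi x y.  It is positive because the norm of
   M <x, y> - phi x y is at most M ||x|| ||y|| for M = ||theta||^2 + 1.

   The order and the square roots needed come from the iteration solving
   (1 - y)^2 = 1 - t for ||t|| <= 1, applied in M(A), which contains A as an
   ideal; no Gelfand theory is involved. *)

From HB Require Import structures.
Require Import Defs.
From mathcomp Require Import all_boot all_order all_algebra.
From mathcomp Require Import all_classical all_reals all_analysis.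
From mathcomp Require Import complex.
From mathcomp Require Import ring lra.

Set Implicit Arguments.
Unset Strict Implicit.
Unset Printing Implicit Defensive.

Import Order.TTheory GRing.Theory Num.Theory.
Import numFieldNormedType.Exports.

Local Open Scope ring_scope.
Local Open Scope complex_scope.
Local Open Scope cstar_scope.

(** Two obstacles shape the argument. [theta] is not known to be continuous, so nothing proved on a
    dense set passes to E until boundedness is established. And A may lack a unit, so signs,
    inverses and spectral projections live at first only in M(A); a projection P of M(A) on which
    <x, x> is bounded below returns to A because it factors through P <x, x> P and A is an ideal.
    Vectors z with <z, z> a projection are singled out because they generate complemented submodules
    z A; for a general vector no complement need exist, and orthogonality says little about it. Real
    rank zero speaks of A or its unitization, so its use in p A p requires moving an invertible
    element into the corner at the cost of a fixed fraction of the norm. The uniform boundedness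
    principle is applied to the maps phi w with ||theta w|| <= 1, bounded at y by ||theta y||.
    Fullness enters twice: an element a is determined by the products a <x, y>, and the norm of a
    self-adjoint a is at most that of its right action on E. *)

Section RealNorm.
Variables (R : realType) (V : normedModType R[i]).
Implicit Types (x y z : V) (r : R).

(** Norms live in [R[i]], whose order is only partial; the real part loses nothing by [nrE] and is
    open to real arithmetic. *)
Definition nr x : R := complex.Re `|x|.

Lemma nrE x : `|x| = (nr x)%:C.
Proof.
have : 0 <= `|x| by [].
by rewrite /nr; case: `|x| => a b; rewrite lecE /= => /andP[/eqP -> _].
Qed.

Lemma nr_ge0 x : 0 <= nr x.
Proof. by have := normr_ge0 x; rewrite nrE lecR. Qed.

Lemma nr0 : nr 0 = 0. Proof. by rewrite /nr normr0. Qed.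

Lemma nr0_eq0 x : nr x = 0 -> x = 0.
Proof. by move=> h; apply/normr0_eq0; rewrite nrE h. Qed.

Lemma nrN x : nr (- x) = nr x. Proof. by rewrite /nr normrN. Qed.

Lemma nr_dist x y : nr (x - y) = nr (y - x). Proof. by rewrite -nrN opprB. Qed.

Lemma nrD x y : nr (x + y) <= nr x + nr y.
Proof. by have := ler_normD x y; rewrite !nrE -rmorphD lecR. Qed.

Lemma nrB x y : nr (x - y) <= nr x + nr y.
Proof. by rewrite -(nrN y); exact: nrD. Qed.

Lemma nr_le_dist x y : nr x <= nr y + nr (x - y).
Proof. by rewrite -{1}(subrKC y x) nrD. Qed.

Lemma nr_dist_triangle z x y : nr (x - y) <= nr (x - z) + nr (z - y).
Proof. by rewrite -{1}(subrK z x) -addrA nrD. Qed.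

Lemma nrZ (k : R[i]) x : nr (k *: x) = complex.Re `|k| * nr x.
Proof.
rewrite {1}/nr normrZ nrE.
have : 0 <= `|k| by [].
by case: `|k| => a b; rewrite lecE /= => /andP[/eqP -> _]; rewrite mul0r subr0.
Qed.

Lemma nrZr r x : nr (r%:C *: x) = `|r| * nr x.
Proof. by rewrite nrZ normc_def /= expr0n /= addr0 sqrtr_sqr. Qed.

Lemma nrZi x : nr ('i *: x) = nr x.
Proof. by rewrite nrZ normc_def /= expr0n expr1n add0r sqrtr1 mul1r. Qed.

Lemma nr_small_eq0 (C : R) x : (forall e, 0 < e -> nr x <= C * e) -> x = 0.
Proof.
move=> h; apply: nr0_eq0; apply/eqP; rewrite eq_le nr_ge0 andbT.
have C1 : 0 < `|C| + 1 by apply: ltr_wpDl.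
apply/ler_addgt0Pr => e e0; rewrite add0r.
apply: (le_trans (h (e / (`|C| + 1)) _)); first by rewrite divr_gt0.
rewrite mulrCA ger_pMr// ler_pdivrMr// mul1r.
by have := ler_norm C; lra.
Qed.

End RealNorm.

(** * Sequential convergence and completeness *)

Section Sequences.
Variable R : realType.

Definition tends (V : normedModType R[i]) (u : nat -> V) (l : V) :=
  forall e : R, 0 < e -> exists N, forall n, (N <= n)%N -> nr (u n - l) < e.

Lemma nr_complete (V : completeNormedModType R[i]) (u : nat -> V) :
  (forall e : R, 0 < e -> exists N, forall n m, (N <= n)%N -> (N <= m)%N ->
     nr (u n - u m) < e) -> exists l, tends u l.
Proof.
move=> uC.
have : cauchy (u @ \oo)%classic.
  apply: cauchy_exP => e e0; rewrite /fmapE.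
  have e0' : 0 < complex.Re e by case: e e0 => a b; rewrite ltcE => /andP[].
  have [N hN] := uC _ e0'.
  exists (u N), N => // n /= Nn; rewrite -ball_normE /ball_ /= nrE.
  have -> : e = (complex.Re e)%:C.
    by move: e0; case: e {e0' hN} => a b; rewrite ltcE /= => /andP[/eqP -> _].
  by rewrite ltcR; apply: hN.
move=> /cauchy_cvg /cvg_ex [l ul]; exists l => e e0.
move/cvgrPdist_lt : ul => /(_ e%:C); rewrite ltcR => /(_ e0) [N _ hN].
by exists N => n Nn; have := hN n Nn; rewrite /= nrE ltcR nr_dist.
Qed.

End Sequences.

(* Reflection for the tactic [lmod], which reduces an identity between linear
   combinations in a left module to identities between their coefficients. *)
Section LinearCombinations.
Variables (K : pzRingType) (V : lmodType K).

Inductive lexp :=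
  LVar of nat | LZero | LAdd of lexp & lexp | LOpp of lexp
| LScale of K & lexp.

Fixpoint leval (env : seq V) (f : lexp) : V :=
  match f with
  | LVar i => nth 0 env i
  | LZero => 0
  | LAdd f g => leval env f + leval env g
  | LOpp f => - leval env f
  | LScale k f => k *: leval env f
  end.

Fixpoint lcoef (f : lexp) (i : nat) : K :=
  match f with
  | LVar j => if eqn i j then 1 else 0
  | LZero => 0
  | LAdd f g => lcoef f i + lcoef g i
  | LOpp f => - lcoef f i
  | LScale k f => k * lcoef f i
  end.

Lemma levalE env f :
  leval env f = \sum_(i < size env) lcoef f i *: nth 0 env i.
Proof.
elim: f => [j||f IHf g IHg|f IHf|k f IHf] /=.
- have [jn|nj] := ltnP j (size env).
    rewrite (bigD1 (Ordinal jn))//= [eqn j j]eqxx scale1r big1 ?addr0// => i ij.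
    case: eqnP => [e|_]; last by rewrite scale0r.
    by move: ij; rewrite -val_eqE /= e eqxx.
  rewrite nth_default// big1// => i _.
  case: eqnP => [e|_]; last by rewrite scale0r.
  by move: (ltn_ord i); rewrite e ltnNge nj.
- by rewrite big1// => i _; rewrite scale0r.
- by rewrite IHf IHg -big_split; apply: eq_bigr => i _; rewrite scalerDl.
- by rewrite IHf -sumrN; apply: eq_bigr => i _; rewrite scaleNr.
- by rewrite IHf scaler_sumr; apply: eq_bigr => i _; rewrite scalerA.
Qed.

Fixpoint lcoef_eq (n : nat) (f g : lexp) : Prop :=
  if n is n'.+1 then lcoef f n' = lcoef g n' /\ lcoef_eq n' f g else True.

Lemma leval_eq env f g : lcoef_eq (size env) f g -> leval env f = leval env g.
Proof.
have lcoefE n i : lcoef_eq n f g -> (i < n)%N -> lcoef f i = lcoef g i.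
  elim: n => // n IHn /= [fg /IHn fgn].
  by rewrite ltnS leq_eqVlt => /predU1P[->|/fgn].
move=> fg; rewrite !levalE; apply: eq_bigr => i _.
by rewrite (lcoefE _ _ fg (ltn_ord i)).
Qed.

End LinearCombinations.

Ltac lm_mem x env :=
  match env with
  | @cons _ x _ => constr:(true)
  | @cons _ _ ?l => lm_mem x l
  | _ => constr:(false)
  end.
Ltac lm_add x env :=
  match lm_mem x env with
  | true => env
  | false => constr:(@cons _ x env)
  end.
Ltac lm_idx x env :=
  match env with
  | @cons _ x _ => constr:(0%N)
  | @cons _ _ ?l => let n := lm_idx x l in constr:(S n)
  end.
Ltac lm_env t env :=
  match t with
  | GRing.add ?a ?b => let env := lm_env a env in lm_env b env
  | GRing.opp ?a => lm_env a env
  | GRing.scale _ ?a => lm_env a env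
  | GRing.zero => env
  | _ => lm_add t env
  end.
Ltac lm_reify K t env :=
  match t with
  | GRing.add ?a ?b =>
      let f := lm_reify K a env in let g := lm_reify K b env in
      constr:(@LAdd K f g)
  | GRing.opp ?a => let f := lm_reify K a env in constr:(@LOpp K f)
  | GRing.scale ?k ?a =>
      let f := lm_reify K a env in constr:(@LScale K k f)
  | GRing.zero => constr:(@LZero K)
  | _ => let i := lm_idx t env in constr:(@LVar K i)
  end.
Ltac lm_pre :=
  lazymatch goal with R : realType |- @eq ?V ?a ?b =>
    let K := constr:((complex R : pzRingType)) in
    let env := lm_env a (@nil V) in
    let env := lm_env b env in
    let f := lm_reify K a env in
    let g := lm_reify K b env in
    change (leval env f = leval env g)
  end;
  apply: leval_eq;
  cbn [lcoef_eq lcoef size eqn];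
  repeat match goal with |- _ /\ _ => split end; try exact: I.

Ltac lmod := lm_pre; try ring; (field; rewrite ?fmorph_eq0 //).

(** * Elementary algebra in a C*-algebra *)

Section CstarBasics.
Variables (R : realType) (A : cstarAlgType R).
Implicit Types (a b c p : A) (k : R[i]).

Lemma cmul0r a : a ** 0 = 0.
Proof. by apply: (addrI (a ** 0)); rewrite -cmulDr !addr0. Qed.

Lemma cmul0l a : 0 ** a = 0.
Proof. by apply: (addrI (0 ** a)); rewrite -cmulDl !addr0. Qed.

Lemma cmulNr a b : a ** (- b) = - (a ** b).
Proof. by rewrite -scaleN1r cmulZr scaleN1r. Qed.

Lemma cmulNl a b : (- a) ** b = - (a ** b).
Proof. by rewrite -scaleN1r cmulZl scaleN1r. Qed.

Lemma star0 : star 0 = 0 :> A.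
Proof. by apply: (addrI (star 0)); rewrite -starD !addr0. Qed.

Lemma starN a : star (- a) = - star a.
Proof. by rewrite -scaleN1r starZ rmorphN rmorph1 scaleN1r. Qed.

Lemma starZr (r : R) a : star (r%:C *: a) = r%:C *: star a.
Proof. by rewrite starZ conjc_real. Qed.

Lemma nrM a b : nr (a ** b) <= nr a * nr b.
Proof. by have := cnormM a b; rewrite !nrE -rmorphM lecR. Qed.

Lemma nr_star a : nr (star a) = nr a.
Proof. by rewrite /nr cnorm_star. Qed.

Lemma nr_starM a : nr (star a ** a) = nr a ^+ 2.
Proof.
by apply: complexI; rewrite rmorphXn/= -!nrE cnorm_starM.
Qed.

Lemma nrM2 a b c : nr (a ** b ** c) <= nr a * nr b * nr c.
Proof. by apply: (le_trans (nrM _ _)); rewrite ler_wpM2r ?nr_ge0 ?nrM. Qed.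

Lemma nrM_le a b (C D : R) : nr a <= C -> nr b <= D -> nr (a ** b) <= C * D.
Proof.
by move=> aC bD; apply: (le_trans (nrM _ _)); rewrite ler_pM ?nr_ge0.
Qed.

Lemma nr_sa_sqr a : selfadjoint a -> nr (a ** a) = nr a ^+ 2.
Proof. by move=> sa; rewrite -nr_starM sa. Qed.

Lemma starM_eq0 a : star a ** a = 0 -> a = 0.
Proof.
move=> h; apply: nr0_eq0; apply/eqP.
by rewrite -sqrf_eq0 -nr_starM h nr0.
Qed.

Lemma sa_sqr_eq0 a : selfadjoint a -> a ** a = 0 -> a = 0.
Proof. by move=> sa h; apply: starM_eq0; rewrite sa. Qed.

Lemma saD a b : selfadjoint a -> selfadjoint b -> selfadjoint (a + b).
Proof. by rewrite /selfadjoint starD => -> ->. Qed.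

Lemma saN a : selfadjoint a -> selfadjoint (- a).
Proof. by rewrite /selfadjoint starN => ->. Qed.

Lemma saB a b : selfadjoint a -> selfadjoint b -> selfadjoint (a - b).
Proof. by move=> sa sb; apply: saD sa (saN sb). Qed.

Lemma saZ (r : R) a : selfadjoint a -> selfadjoint (r%:C *: a).
Proof. by rewrite /selfadjoint starZr => ->. Qed.

Lemma saM a b :
  selfadjoint a -> selfadjoint b -> a ** b = b ** a -> selfadjoint (a ** b).
Proof. by rewrite /selfadjoint starM => -> -> ->. Qed.

Lemma sa_conj a b : selfadjoint a -> selfadjoint (star b ** a ** b).
Proof. by rewrite /selfadjoint !starM starK cmulA => ->. Qed.

Definition projection p := selfadjoint p /\ p ** p = p.

Lemma nr_projection p : projection p -> nr p <= 1.
Proof.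
case=> sp pp; have : nr p ^+ 2 = nr p by rewrite -nr_sa_sqr// pp.
have := nr_ge0 p; set x := nr p => x0 xx.
rewrite leNgt; apply/negP => x1.
have : x * (x - 1) = 0 by rewrite mulrBr -expr2 xx mulr1 subrr.
by move/eqP; rewrite mulf_eq0 => /orP[] /eqP; lra.
Qed.

Definition ccomm a b := a ** b = b ** a.

Lemma ccommC a b : ccomm a b -> ccomm b a. Proof. by []. Qed.

Lemma ccommD a b c : ccomm a b -> ccomm a c -> ccomm a (b + c).
Proof. by rewrite /ccomm cmulDr cmulDl => -> ->. Qed.

Lemma ccommN a b : ccomm a b -> ccomm a (- b).
Proof. by rewrite /ccomm cmulNr cmulNl => ->. Qed.

Lemma ccommB a b c : ccomm a b -> ccomm a c -> ccomm a (b - c).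
Proof. by move=> ab ac; apply: ccommD ab (ccommN ac). Qed.

Lemma ccommZ k a b : ccomm a b -> ccomm a (k *: b).
Proof. by rewrite /ccomm cmulZr cmulZl => ->. Qed.

Lemma ccommM a b c : ccomm a b -> ccomm a c -> ccomm a (b ** c).
Proof. by rewrite /ccomm => ab ac; rewrite cmulA ab -cmulA ac cmulA. Qed.

(** Membership of [b] in the bicommutant of [a]. It stands in for functional calculus: whatever is
    constructed from [a] commutes with all that commutes with [a]. *)
Definition bicomm a b := forall c, ccomm c a -> ccomm c b.

Lemma conjci : conjc 'i = - 'i :> R[i].
Proof. by apply/eqP; rewrite eq_complex /= oppr0 !eqxx. Qed.

Lemma decomp_sa c : exists u v : A,
  [/\ selfadjoint u, selfadjoint v & c = u + 'i *: v].
Proof.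
exists ((2^-1)%:C *: (c + star c)), ((2^-1)%:C *: ('i *: (star c - c))).
have i2 : 'i * 'i = -1 :> R[i] by rewrite -expr2 sqr_i.
split.
- by apply: saZ; rewrite /selfadjoint starD starK addrC.
- by apply: saZ; rewrite /selfadjoint starZ starD starN starK conjci scaleNr
    -scalerN opprB.
- lm_pre.
  + have -> : (2^-1)%:C = 2^-1 :> R[i] by rewrite fmorphV rmorph_nat.
    apply: (mulfI (x := 2)); first by rewrite pnatr_eq0.
    transitivity ((2 / 2) * (1 - 'i * 'i) : R[i]); last by ring.
    by rewrite i2 divff ?pnatr_eq0//; ring.
  + transitivity ((2^-1)%:C * (1 + 'i * 'i) : R[i]); last by ring.
    by rewrite i2 subrr mulr0.
Qed.

End CstarBasics.

Ltac ncexpand := rewrite ?(cmulDl, cmulDr, cmulNl, cmulNr, cmulZl, cmulZr,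
  cmul0l, cmul0r, scalerDr, scalerN, opprD, opprK, cmulA).

(** * Limits and the algebraic operations *)

Section Tends.
Variables (R : realType).

Section V.
Variable (V : normedModType R[i]).
Implicit Types (u v : nat -> V) (x y : V).

Lemma tends_ext u v x : u =1 v -> tends u x -> tends v x.
Proof. by move=> uv h e /h[N hN]; exists N => n /hN; rewrite uv. Qed.

Lemma tends_cst x : tends (fun=> x) x.
Proof. by move=> e e0; exists 0%N => n _; rewrite subrr nr0. Qed.

Lemma tends_squeeze (W : normedModType R[i]) u x (C : R) (v : nat -> W)
    (y : W) :
  tends v y ->
  (forall n, nr (u n - x) <= C * nr (v n - y)) -> tends u x.
Proof.
move=> vy h e e0.
have C1 : 0 < `|C| + 1 by apply: ltr_wpDl.
have [|N hN] := vy (e / (`|C| + 1)); first by rewrite divr_gt0.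
exists N => n /hN; rewrite ltr_pdivlMr// => h1; apply: le_lt_trans (h n) _.
apply: le_lt_trans h1; rewrite mulrC ler_wpM2l ?nr_ge0//.
by have := ler_norm C; lra.
Qed.

Lemma tendsD u v x y :
  tends u x -> tends v y -> tends (fun n => u n + v n) (x + y).
Proof.
move=> ux vy e e0.
have [|N hN] := ux (e / 2); first by rewrite divr_gt0.
have [|M hM] := vy (e / 2); first by rewrite divr_gt0.
exists (maxn N M) => n; rewrite geq_max => /andP[/hN h1 /hM h2].
by rewrite opprD addrACA; apply: le_lt_trans (nrD _ _) _; lra.
Qed.

Lemma tendsZ k u x : tends u x -> tends (fun n => k *: u n) (k *: x).
Proof.
by move=> ux; apply: (tends_squeeze (C := complex.Re `|k|) ux) => n;
  rewrite -scalerBr nrZ.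
Qed.

Lemma tendsN u x : tends u x -> tends (fun n => - u n) (- x).
Proof.
by move=> ux; apply: (tends_squeeze (C := 1) ux) => n; rewrite -opprD nrN mul1r.
Qed.

Lemma tendsB u v x y :
  tends u x -> tends v y -> tends (fun n => u n - v n) (x - y).
Proof. by move=> ux vy; apply: tendsD ux (tendsN vy). Qed.

Lemma tendsS u x : tends u x -> tends (fun n => u n.+1) x.
Proof. by move=> h e /h[N hN]; exists N => n Nn; apply: hN; apply: leqW. Qed.

Lemma tends_le u x (C : R) :
  tends u x -> (forall n, nr (u n) <= C) -> nr x <= C.
Proof.
move=> ux h; apply/ler_addgt0Pr => e e0; have [N hN] := ux e e0.
have := hN N (leqnn _); rewrite nr_dist => h1.
by have := nr_le_dist x (u N); have := h N; lra.
Qed.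

Lemma tends_unique u x y : tends u x -> tends u y -> x = y.
Proof.
move=> ux uy; apply/eqP; rewrite -subr_eq0; apply/eqP.
apply: nr0_eq0; apply/eqP; rewrite eq_le nr_ge0 andbT.
apply: (tends_le (tendsB ux uy)) => n; by rewrite subrr nr0.
Qed.

Lemma tends_cauchy u x : tends u x -> forall e, 0 < e ->
  exists N, forall n m, (N <= n)%N -> (N <= m)%N -> nr (u n - u m) < e.
Proof.
move=> ux e e0; have [|N hN] := ux (e / 2); first by rewrite divr_gt0.
exists N => n m /hN h1 /hN; rewrite nr_dist => h2.
by apply: le_lt_trans (nr_dist_triangle x _ _) _; lra.
Qed.

End V.

(** Majorant principle: [z] is nondecreasing and bounded, hence Cauchy, and its increments control
    those of [u]. It serves the square root, the Neumann inverse and the nested balls of uniform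
    boundedness. *)
Lemma dominated_tends (V : completeNormedModType R[i]) (u : nat -> V)
    (z : nat -> R) (M : R) :
  (forall n, nr (u n.+1 - u n) <= z n.+1 - z n) -> (forall n, z n <= M) ->
  exists2 l, tends u l & forall n, nr (l - u n) <= M - z n.
Proof.
move=> uz zM.
have z_dist n m : z n <= z (n + m)%N /\
    nr (u (n + m)%N - u n) <= z (n + m)%N - z n.
  elim: m => [|m [IH1 IH2]]; first by rewrite addn0 !subrr nr0.
  have h1 := uz (n + m)%N; have h2 := nr_ge0 (u (n + m).+1 - u (n + m)%N).
  rewrite addnS; split; first by lra.
  by apply: le_trans (nr_dist_triangle (u (n + m)%N) _ _) _; lra.
have [|l ul] := @nr_complete _ V u; last first.
  exists l => // n.
  have h : tends (fun m => u (m + n)%N - u n) (l - u n).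
    apply: tendsB (tends_cst _) => r /ul [N hN].
    by exists N => m Nm; apply: hN; rewrite (leq_trans Nm)// leq_addr.
  apply: (tends_le h) => m; have [_ h1] := z_dist n m; rewrite addnC.
  by apply: le_trans h1 _; rewrite lerD2r.
move=> r r0; have z_sup : has_sup (range z).
  by split; [exists (z 0%N), 0%N|exists M => _ [n _ <-]].
have r20 : 0 < r / 2 by rewrite divr_gt0.
have [_ [N _ <-] zN] := sup_adherent r20 z_sup.
have z_ub n : z n <= sup (range z) by apply: sup_upper_bound => //; exists n.
have d n : (N <= n)%N -> nr (u n - u N) < r / 2.
  move=> Nn; have [_] := z_dist N (n - N)%N; rewrite subnKC// => h1.
  by have := z_ub n; lra.
exists N => n m /d h1 /d; rewrite nr_dist => h2.
by apply: le_lt_trans (nr_dist_triangle (u N) _ _) _; lra.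
Qed.

Section A.
Variable (A : cstarAlgType R).
Implicit Types (u v : nat -> A) (x y : A).

Lemma tendsMl a u x : tends u x -> tends (fun n => a ** u n) (a ** x).
Proof.
move=> ux; apply: (tends_squeeze (C := nr a) ux) => n.
by rewrite -cmulNr -cmulDr nrM.
Qed.

Lemma tendsMr a u x : tends u x -> tends (fun n => u n ** a) (x ** a).
Proof.
move=> ux; apply: (tends_squeeze (C := nr a) ux) => n.
by rewrite -cmulNl -cmulDl mulrC nrM.
Qed.

Lemma tends_star u x : tends u x -> tends (fun n => star (u n)) (star x).
Proof.
move=> ux; apply: (tends_squeeze (C := 1) ux) => n.
by rewrite -starN -starD nr_star mul1r.
Qed.

Lemma tends_sqr u x C : (forall n, nr (u n) <= C) -> tends u x ->
  tends (fun n => u n ** u n) (x ** x).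
Proof.
move=> uC ux; apply: (tends_squeeze (C := C + nr x) ux) => n.
have -> : u n ** u n - x ** x = u n ** (u n - x) + (u n - x) ** x.
  by rewrite cmulDl cmulDr cmulNl cmulNr addrA subrK.
apply: le_trans (nrD _ _) _; rewrite mulrDl lerD//.
  by apply: le_trans (nrM _ _) _; rewrite ler_wpM2r ?nr_ge0.
by rewrite mulrC nrM.
Qed.

End A.
End Tends.

(** * Square roots, positivity and inverses in a unital C*-algebra *)

Section Unital.
Variables (R : realType) (B : cstarAlgType R) (e : B).
Hypothesis eP : is_unit_elt e.
Implicit Types (a b c s t : B) (r M : R).

Lemma cmul1l a : e ** a = a. Proof. by case: (eP a). Qed.
Lemma cmul1r a : a ** e = a. Proof. by case: (eP a). Qed.

Local Ltac nc := ncexpand; rewrite ?(cmul1l, cmul1r); lmod.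

Lemma star1 : star e = e.
Proof. by rewrite -[LHS]cmul1r -{2}(starK e) -starM cmul1r starK. Qed.

Lemma sa1 : selfadjoint e. Proof. exact: star1. Qed.

Lemma nr1_le : nr e <= 1.
Proof. by apply: nr_projection; split; [exact: sa1|exact: cmul1l]. Qed.

Lemma nrZ1_le r : 0 <= r -> nr (r%:C *: e) <= r.
Proof.
by move=> r0; rewrite nrZr ger0_norm// ler_piMr// nr1_le.
Qed.

Lemma ccomm1 a : ccomm a e. Proof. by rewrite /ccomm cmul1l cmul1r. Qed.

Section SquareRoot.
Variable t : B.
Hypothesis t_sa : selfadjoint t.
Hypothesis t_le1 : nr t <= 1.

Let h : R := 2^-1.

(* Fixed point iteration for y = (t + y^2) / 2, whose solution satisfies
   (1 - y)^2 = 1 - t; the same iteration run on the scalar 1 dominates it. *)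
Let y := fix y n : B := if n is n'.+1 then h%:C *: (t + y n' ** y n') else 0.
Let z := fix z n : R := if n is n'.+1 then h * (1 + z n' * z n') else 0.

Let z_ge0 n : 0 <= z n.
Proof.
elim: n => //= n zn; rewrite mulr_ge0 ?invr_ge0// addr_ge0// mulr_ge0//.
Qed.

Let z_le1 n : z n <= 1.
Proof.
elim: n => [|n zn] /=; first exact: ler01.
have := z_ge0 n; rewrite /h; nra.
Qed.

Let nr_y n : nr (y n) <= z n.
Proof.
elim: n => [|n IHn] /=; first by rewrite nr0.
rewrite nrZr ger0_norm ?invr_ge0// ler_wpM2l ?invr_ge0//.
by apply: le_trans (nrD _ _) _; rewrite lerD//; apply: nrM_le.
Qed.

Let nr_yS n : nr (y n.+1 - y n) <= z n.+1 - z n.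
Proof.
elim: n => [|n IHn].
  rewrite /= cmul0l addr0 subr0 mulr0 addr0 subr0 mulr1 nrZr.
  by rewrite ger0_norm ?invr_ge0// ler_piMr// invr_ge0.
have -> : y n.+2 - y n.+1 =
    h%:C *: (y n.+1 ** (y n.+1 - y n) + (y n.+1 - y n) ** y n).
  rewrite [y n.+2]/= -/(y n.+1) [in X in _ - X]/=.
  move: (y n.+1) (y n) => a b.
  by nc.
have -> : z n.+2 - z n.+1 =
    h * (z n.+1 * (z n.+1 - z n) + (z n.+1 - z n) * z n) by rewrite /=; ring.
rewrite nrZr ger0_norm ?invr_ge0// ler_wpM2l ?invr_ge0//.
by apply: le_trans (nrD _ _) _; apply: lerD; apply: nrM_le.
Qed.

Let y_sa n : selfadjoint (y n).
Proof.
elim: n => [|n IHn] /=; first exact: star0.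
by apply: saZ; apply: saD => //; apply: saM.
Qed.

Let y_bicomm n : bicomm t (y n).
Proof.
elim: n => [|n IHn] c ct /=; first by rewrite /ccomm cmul0l cmul0r.
by apply: ccommZ; apply: ccommD => //; apply: ccommM; apply: IHn.
Qed.

(** [s] is e - l for the fixed point l of the iteration: 2 l = t + l^2 says (e - l)^2 = e - t. The
    majorant stays below 1 even when [nr t] is 1, so no strict inequality is asked of [t]. The bound
    on e - s is what later makes [s] itself positive. *)
Lemma sqrt1B : exists s,
  [/\ selfadjoint s, s ** s = e - t, nr (e - s) <= 1 & bicomm t s].
Proof.
have [l yl _] := dominated_tends nr_yS z_le1.
have y_le1 n : nr (y n) <= 1 by apply: le_trans (nr_y n) (z_le1 n).
have l_sa : selfadjoint l.
  apply: (tends_unique (tends_star yl)).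
  by apply: tends_ext yl => n; rewrite y_sa.
have lE : l = h%:C *: (t + l ** l).
  apply: (tends_unique (tendsS yl)); apply: tendsZ.
  by apply: tendsD; [exact: tends_cst|exact: tends_sqr y_le1 yl].
exists (e - l); split.
- by apply: saB l_sa; exact: sa1.
- have l2 : l + l = t + l ** l.
    rewrite {1 2}lE; move: (l ** l) => a; rewrite /h; lmod.
  transitivity (e - (l + l) + l ** l); first by nc.
  by rewrite l2; lmod.
- by rewrite opprB addrC subrK; apply: tends_le yl y_le1.
- move=> c ct; apply: ccommB; first exact: ccomm1.
  apply: (tends_unique (tendsMl c yl)); apply: tends_ext (tendsMr c yl).
  by move=> n; apply/esym/y_bicomm.
Qed.

End SquareRoot.

(* w = s + i b satisfies w^* w = r 1, and b is the imaginary part of w. *)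
Lemma sqr_sum_le s b r : selfadjoint s -> selfadjoint b -> ccomm s b ->
  s ** s + b ** b = r%:C *: e -> 0 <= r -> nr b ^+ 2 <= r.
Proof.
move=> ss sb sbC sE r0; pose w := s + 'i *: b.
have wE : star w = s - 'i *: b by rewrite starD starZ ss sb conjci scaleNr.
have i2 : 'i * 'i = - 1 :> R[i] by rewrite -expr2 sqr_i.
have ww : star w ** w = r%:C *: e.
  rewrite -sE wE /w; ncexpand; rewrite sbC !scalerA i2 scaleN1r.
  by lmod.
have nw : nr w ^+ 2 <= r by rewrite -nr_starM ww nrZ1_le.
apply: le_trans nw; rewrite lerXn2r ?nnegrE ?nr_ge0//.
have bE : 'i *: b = (2^-1)%:C *: (w - star w) by rewrite wE /w; lmod.
rewrite -nrZi bE nrZr ger0_norm ?invr_ge0//.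
have := nrB w (star w); rewrite nr_star; lra.
Qed.

Lemma sub_sqr b M : selfadjoint b -> nr b ^+ 2 <= M -> 0 < M ->
  exists s, [/\ selfadjoint s, s ** s = M%:C *: e - b ** b & bicomm (b ** b) s].
Proof.
move=> sb bM M0.
have [|| s [ss sE _ sC]] := @sqrt1B ((M^-1)%:C *: (b ** b)).
- exact/saZ/saM.
- rewrite nrZr ger0_norm ?invr_ge0 ?(ltW M0)// ler_pdivrMl// mulr1.
  by rewrite nr_sa_sqr.
exists ((Num.sqrt M)%:C *: s); split; first exact: saZ.
  rewrite cmulZl cmulZr scalerA -rmorphM -expr2 sqr_sqrtr ?(ltW M0)// sE.
  by lmod; apply: lt0r_neq0.
by move=> c cb; apply/ccommZ/sC/ccommZ.
Qed.

(** With s^2 = M - b^2, the relation s^2 + b^2 = M bounds s as well as b, and ||s^2|| = ||s||^2. *)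
Lemma sqr_near b M : selfadjoint b -> nr b ^+ 2 <= M -> 0 < M ->
  nr (M%:C *: e - b ** b) <= M.
Proof.
move=> sb bM M0; have [s [ss sE sC]] := sub_sqr sb bM M0.
rewrite -sE nr_sa_sqr//; apply: (@sqr_sum_le b) (ltW M0) => //; last first.
  by rewrite sE; lmod.
by apply: sC; rewrite /ccomm cmulA.
Qed.

(** The root is not asked to be positive. The bicommutant clause makes roots of commuting elements
    commute, as [sqr_sum_le] demands. *)
Definition pos a := exists b, [/\ selfadjoint b, b ** b = a & bicomm a b].

Lemma pos_sa a : pos a -> selfadjoint a.
Proof. by case=> b [sb <- _]; apply: saM. Qed.

(** Together with [pos_near] this characterizes positivity by the norm: a self-adjoint [a] with
    ||a|| <= M is positive exactly when ||M - a|| <= M. Sums of positive elements are then handled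
    by the triangle inequality. *)
Lemma near_pos a M : selfadjoint a -> 0 < M -> nr (M%:C *: e - a) <= M -> pos a.
Proof.
move=> sa M0 aM.
have [|| s [ss sE _ sC]] := @sqrt1B (e - (M^-1)%:C *: a).
- by apply: saB; [exact: sa1|exact: saZ].
- have -> : e - (M^-1)%:C *: a = (M^-1)%:C *: (M%:C *: e - a).
    by lmod; apply: lt0r_neq0.
  by rewrite nrZr ger0_norm ?invr_ge0 ?(ltW M0)// ler_pdivrMl// mulr1.
exists ((Num.sqrt M)%:C *: s); split; first exact: saZ.
  rewrite cmulZl cmulZr scalerA -rmorphM -expr2 sqr_sqrtr ?(ltW M0)// sE.
  by lmod; apply: lt0r_neq0.
move=> c ca; apply/ccommZ/sC; apply: ccommB; first exact: ccomm1.
exact: ccommZ.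
Qed.

Lemma pos_near a M : pos a -> nr a <= M -> 0 < M -> nr (M%:C *: e - a) <= M.
Proof. by case=> b [sb <- _]; rewrite nr_sa_sqr//; apply: sqr_near. Qed.

(** [b] need not lie in the bicommutant of its square, so it is not the witness; the root is
    supplied by [near_pos]. *)
Lemma pos_sqr b : selfadjoint b -> pos (b ** b).
Proof.
move=> sb; have M0 : 0 < nr b ^+ 2 + 1 by rewrite ltr_wpDl// sqr_ge0.
apply: near_pos (M0) _; first exact: saM.
by apply: sqr_near => //; rewrite lerDl.
Qed.

Lemma pos1 : pos e.
Proof. by rewrite -(cmul1l e); apply: pos_sqr sa1. Qed.

Lemma posZ r a : 0 <= r -> pos a -> pos (r%:C *: a).
Proof.
move=> r0 [b [sb <- _]].
have -> : r%:C *: (b ** b) = ((Num.sqrt r)%:C *: b) ** ((Num.sqrt r)%:C *: b).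
  by rewrite cmulZl cmulZr scalerA -rmorphM -expr2 sqr_sqrtr.
exact/pos_sqr/saZ.
Qed.

Lemma posD a b : pos a -> pos b -> pos (a + b).
Proof.
move=> pa pb; set M := nr a + nr b + 1.
have a0 := nr_ge0 a; have b0 := nr_ge0 b; have M0 : 0 < M by rewrite /M; lra.
apply: (@near_pos _ (M + M)); first by apply: saD; apply: pos_sa.
  by lra.
have -> : (M + M)%:C *: e - (a + b) = (M%:C *: e - a) + (M%:C *: e - b) by lmod.
apply: le_trans (nrD _ _) _.
by apply: lerD; apply: pos_near => //; rewrite /M; lra.
Qed.

Lemma pos_addr r a : selfadjoint a -> nr a <= r -> pos (r%:C *: e + a).
Proof.
move=> sa ar.
have p0 : pos 0 by rewrite -(cmul0l 0); apply/pos_sqr/star0.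
have [r0|r0] := ltrP 0 r; last first.
  have -> : r = 0 by apply/eqP; rewrite eq_le r0 (le_trans (nr_ge0 a) ar).
  rewrite scale0r add0r (_ : a = 0)//; apply/nr0_eq0/eqP.
  by rewrite eq_le nr_ge0 andbT (le_trans ar).
apply: (near_pos _ r0); first by apply: saD => //; apply/saZ/sa1.
by rewrite opprD addrA subrr add0r nrN.
Qed.

(** The roots b of a and s of M - a commute by their bicommutant clauses, and s^2 + b^2 = M bounds
    b. *)
Lemma pos_le a M : 0 <= M -> pos a -> pos (M%:C *: e - a) -> nr a <= M.
Proof.
move=> M0 [b [sb bE bC]] [s [ss sE sC]].
rewrite -bE nr_sa_sqr//; apply: (sqr_sum_le ss) => //; last first.
  by rewrite sE bE; lmod.
apply: bC; apply: ccommC; apply: sC; apply: ccommB; last by [].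
by apply: ccommZ; apply: ccomm1.
Qed.

Lemma pos_sub a M : pos a -> nr a <= M -> pos (M%:C *: e - a).
Proof. by move=> /pos_sa sa aM; apply: pos_addr; [exact: saN|rewrite nrN]. Qed.

Definition inverse a b := a ** b = e /\ b ** a = e.

Lemma inverse_sa a b : selfadjoint a -> inverse a b -> selfadjoint b.
Proof.
move=> sa [ab ba]; rewrite /selfadjoint -[LHS]cmul1r -ab cmulA -{1}sa -starM.
by rewrite ab star1 cmul1l.
Qed.

Lemma inverse_bicomm a b : inverse a b -> bicomm a b.
Proof.
move=> [ab ba] c ca.
by rewrite /ccomm -[LHS]cmul1l -ba -!cmulA (cmulA a) -ca -cmulA ab cmul1r.
Qed.

(** Fixed point iteration for M y = e + (M - m) y. The scalar iteration with [q] in place of M - m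
    dominates it and stays below its fixed point 1 / (M - q). The iterates commute with [m], so the
    right inverse is also a left inverse. *)
Lemma neumann m M q : nr (M%:C *: e - m) <= q -> q < M ->
  exists2 j, inverse m j & nr j <= (M - q)^-1.
Proof.
move=> mq qM.
have q0 : 0 <= q by apply: le_trans mq; exact: nr_ge0.
have M0 : 0 < M by lra.
have Mq : 0 < M - q by lra.
pose h := M%:C *: e - m.
pose y := fix y n : B :=
  if n is n'.+1 then (M^-1)%:C *: (e + h ** y n') else 0.
pose z := fix z n : R := if n is n'.+1 then M^-1 * (1 + q * z n') else 0.
have Mi : 0 <= M^-1 by rewrite invr_ge0 ltW.
have zM n : z n <= (M - q)^-1.
  elim: n => [|n IHn] /=; first by rewrite invr_ge0 ltW.
  rewrite mulrC ler_pdivrMr//.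
  have -> : (M - q)^-1 * M = 1 + q * (M - q)^-1 by field; apply: lt0r_neq0.
  by rewrite lerD2l ler_wpM2l.
have nyS n : nr (y n.+1 - y n) <= z n.+1 - z n.
  elim: n => [|n IHn].
    rewrite /= cmul0r addr0 subr0 mulr0 addr0 subr0 mulr1 nrZr.
    by rewrite ger0_norm// ler_piMr// nr1_le.
  have -> : y n.+2 - y n.+1 = (M^-1)%:C *: (h ** (y n.+1 - y n)).
    rewrite [y n.+2]/= -/(y n.+1) [in X in _ - X]/=.
    move: (y n.+1) (y n) => a b; ncexpand; lmod.
  have -> : z n.+2 - z n.+1 = M^-1 * (q * (z n.+1 - z n)) by rewrite /=; ring.
  by rewrite nrZr ger0_norm// ler_wpM2l// nrM_le.
have ny n : nr (y n) <= z n.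
  elim: n => [|n IHn] /=; first by rewrite nr0.
  rewrite nrZr ger0_norm// ler_wpM2l//.
  by apply: le_trans (nrD _ _) _; rewrite lerD ?nr1_le// nrM_le.
have yC n : ccomm m (y n).
  elim: n => [|n IHn] /=; first by rewrite /ccomm cmul0l cmul0r.
  apply: ccommZ; apply: ccommD; first exact: ccomm1.
  apply: ccommM => //; apply: ccommB => //.
  by apply: ccommZ; apply: ccomm1.
have [j yj _] := dominated_tends nyS zM.
have jE : j = (M^-1)%:C *: (e + h ** j).
  apply: (tends_unique (tendsS yj)); apply: tendsZ.
  by apply: tendsD; [exact: tends_cst|exact: tendsMl].
have mj : m ** j = e.
  have : M%:C *: j = e + h ** j.
    by rewrite {1}jE scalerA -rmorphM mulfV ?lt0r_neq0// scale1r.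
  rewrite /h cmulDl cmulNl cmulZl cmul1l
    => /(congr1 (fun x => x - M%:C *: j + m ** j)).
  rewrite subrr add0r => ->; lmod.
have jm : j ** m = e.
  rewrite -mj; apply: (tends_unique (tendsMr m yj)).
  by apply: tends_ext (tendsMl m yj) => n; rewrite yC.
exists j => //; apply: (tends_le yj) => n; exact: le_trans (ny n) (zM n).
Qed.

Lemma pos_inverse m r : 0 < r -> selfadjoint m -> pos (m - r%:C *: e) ->
  exists j, inverse m j.
Proof.
move=> r0 sm pm; set M := nr (m - r%:C *: e) + 1.
have M1 := nr_ge0 (m - r%:C *: e).
have h : nr (M%:C *: e - (m - r%:C *: e)) <= M.
  by apply: pos_near => //; rewrite /M; lra.
(* As m - r is positive of norm below M, the element m lies within M of M + r. *)
have [||j jm _] := @neumann m (M + r) M; last by exists j.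
  by rewrite (_ : _ - m = M%:C *: e - (m - r%:C *: e)) //; lmod.
by lra.
Qed.

End Unital.

(** * Absolute values, positivity of b^* b, and signs *)

Section UnitalOrder.
Variables (R : realType) (B : cstarAlgType R) (e : B).
Hypothesis eP : is_unit_elt e.
Implicit Types (a b c s t : B) (r M : R).

Local Notation pos := (pos (B := B)).
Local Notation inverse := (inverse e).
Local Ltac nc := ncexpand; rewrite ?(cmul1l eP, cmul1r eP); lmod.

(** Up to scaling, the root of 1 - (1 - h^2 / M) given by [sqrt1B], whose bound on e - s yields
    positivity through [near_pos]. *)
Lemma exists_abs h : selfadjoint h -> exists m,
  [/\ pos m, m ** m = h ** h & bicomm (h ** h) m].
Proof.
move=> sh; set M := nr h ^+ 2 + 1.
have M0 : 0 < M by rewrite ltr_wpDl// sqr_ge0.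
have Mi : 0 <= M^-1 by rewrite invr_ge0 ltW.
have [|| s [ss sE s1 sC]] := @sqrt1B _ _ e eP (e - (M^-1)%:C *: (h ** h)).
- by apply: saB; [exact: sa1|apply/saZ/saM].
- have -> : e - (M^-1)%:C *: (h ** h) = (M^-1)%:C *: (M%:C *: e - h ** h).
    by lmod; apply: lt0r_neq0.
  rewrite nrZr ger0_norm// ler_pdivrMl// mulr1.
  by apply: sqr_near => //; rewrite lerDl.
exists ((Num.sqrt M)%:C *: s); split.
- apply: (posZ eP); first exact: sqrtr_ge0.
  by apply: (near_pos eP ss ltr01); rewrite scale1r.
- rewrite cmulZl cmulZr scalerA -rmorphM -expr2 sqr_sqrtr ?(ltW M0)// sE.
  by lmod; apply: lt0r_neq0.
- move=> c ch; apply/ccommZ/sC/ccommB; first exact: ccomm1.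
  exact: ccommZ.
Qed.

(* Writing c = u + i v, c c^* = 2 u^2 + 2 v^2 + k^2 is positive, whereas
   c^* c = - k^2 has the same nonzero spectrum as c c^*. *)
Lemma starM_neg c k :
  selfadjoint k -> star c ** c = - (k ** k) -> k = 0.
Proof.
move=> sk ck.
have [u [v [su sv cE]]] := decomp_sa c.
have i2 : 'i * 'i = - 1 :> R[i] by rewrite -expr2 sqr_i.
have cc : c ** star c = 2%:C *: (u ** u) + 2%:C *: (v ** v) + k ** k.
  rewrite -[k ** k]opprK -ck cE starD starZ su sv conjci scaleNr.
  by ncexpand; rewrite !scalerA i2 !scaleN1r; lmod.
have p2 : 0 <= 2 :> R by [].
have pcc : pos (c ** star c).
  rewrite cc; apply: (posD eP); last exact: pos_sqr.
  by apply: (posD eP); apply: (posZ eP) => //; apply: pos_sqr.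
have [/eqP|k0] := eqVneq (nr k) 0; first by move/eqP/nr0_eq0.
set mu := nr k ^+ 2.
have mu0 : 0 < mu by rewrite exprn_gt0// lt_neqAle eq_sym k0 nr_ge0.
have [||j [j1 j2]] := @pos_inverse _ _ e eP (mu%:C *: e + c ** star c) mu mu0.
- by apply: saD; [apply/saZ/sa1|apply: pos_sa].
- by rewrite addrAC subrr add0r.
pose d := mu%:C *: e - k ** k.
have dE : d = mu%:C *: e + star c ** c by rewrite ck.
(* The standard formula carrying an inverse j of mu + c c^* to one of mu + c^* c. *)
pose i := (mu^-1)%:C *: (e - star c ** j ** c).
have inv_d : inverse d i.
  have h1 : star c ** c ** star c ** j = star c - mu%:C *: (star c ** j).
    have h : c ** star c ** j = e - mu%:C *: j by rewrite -j1; nc.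
    by rewrite -(cmulA (star c)) -(cmulA (star c)) h; nc.
  have h2 : star c ** j ** c ** star c = star c - mu%:C *: (star c ** j).
    have h : j ** (c ** star c) = e - mu%:C *: j by rewrite -j2; nc.
    by rewrite -cmulA -cmulA h; nc.
  split; rewrite dE /i; ncexpand; rewrite ?(cmul1l eP, cmul1r eP) ?h1 ?h2.
  + by ncexpand; lmod; apply: lt0r_neq0.
  + by ncexpand; lmod; apply: lt0r_neq0.
have sd : selfadjoint d by apply: saB; [apply/saZ/sa1|apply: saM].
have si := inverse_sa eP sd inv_d.
have iC := inverse_bicomm eP inv_d.
have [s [ss sE sC]] := sub_sqr eP sk (lexx _) mu0.
have ks : ccomm k s by apply: sC; rewrite /ccomm cmulA.
have sd' : ccomm s d.
  apply: ccommB; first by apply/ccommZ/ccomm1.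
  by apply: ccommM; apply/ccommC.
have is_ : ccomm s i by apply: iC.
(* N dominates i, which is the square of i s, so N - i has a root q; then (s q)^2 = N d - e, that
   is, k^2 + (s q)^2 / N = mu - 1 / N. This bounds ||k||^2 by mu - 1 / N, against mu = ||k||^2. The
   summand mu^-1 keeps mu - 1 / N nonnegative. *)
pose N := nr i + 1 + mu^-1.
have mui : 0 < mu^-1 by rewrite invr_gt0.
have i0 := nr_ge0 i.
have N0 : 0 < N by rewrite /N; lra.
have iE : (i ** s) ** (i ** s) = i.
  rewrite cmulA -(cmulA i) is_ -!cmulA sE -/d.
  by case: inv_d => _ ->; rewrite (cmul1r eP).
have sis : selfadjoint (i ** s) by apply: saM => //; apply/ccommC.
have [||q [sq qE qC]] := @sub_sqr _ _ e eP (i ** s) N sis.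
- by rewrite -nr_sa_sqr// iE /N; lra.
- by [].
rewrite iE in qE qC.
have sqC : ccomm s q by apply: qC.
have ki : ccomm k i.
  apply: iC; apply: ccommB; first by apply/ccommZ/ccomm1.
  by rewrite /ccomm cmulA.
have kq : ccomm k q by apply: qC.
have ssq : selfadjoint (s ** q) by apply: saM.
have r0 : 0 <= N^-1 by rewrite invr_ge0 ltW.
have sqE : (s ** q) ** (s ** q) = N%:C *: d - e.
  rewrite cmulA -(cmulA s) -sqC cmulA -(cmulA (s ** s)) sE qE -/d.
  rewrite cmulDr cmulNr cmulZr (cmul1r eP); case: inv_d => -> _.
  by [].
have : nr k ^+ 2 <= mu - N^-1.
  apply: (@sqr_sum_le _ _ e eP ((Num.sqrt N^-1)%:C *: (s ** q))) => //.
  - exact: saZ.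
  - by apply/ccommC/ccommZ/ccommM.
  - rewrite cmulZl cmulZr scalerA -rmorphM -expr2 sqr_sqrtr// sqE /d.
    by lmod; apply: lt0r_neq0.
  - by rewrite subr_ge0 -[leRHS]invrK lef_pV2 ?posrE// /N; lra.
have : 0 < N^-1 by rewrite invr_gt0.
by move=> h1; rewrite -/mu lerDl oppr_ge0 leNgt h1.
Qed.

(** Let m = |h| with root r, and let n = (m - h) / 2 be the negative part of h = b^* b. Then b n has
    square (b n)^* (b n) = n h n = - (r n)^2, so r n = 0 by [starM_neg]. Hence n^2 = m n = 0 and h =
    m. *)
Lemma pos_starM b : pos (star b ** b).
Proof.
have [h hE] : exists h, h = star b ** b by eexists.
rewrite -hE; have sh : selfadjoint h by rewrite /selfadjoint hE starM starK.
have [m [pm mE mC]] := exists_abs sh.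
have hm : ccomm h m by apply: mC; rewrite /ccomm cmulA.
pose n := (2^-1)%:C *: (m - h).
have sm := pos_sa pm.
have sn : selfadjoint n by apply/saZ/saB.
have hn : h ** n = - (m ** n).
  by rewrite /n; ncexpand; rewrite -mE hm; lmod.
have nn : n ** n = m ** n.
  by rewrite /n; ncexpand; rewrite -mE hm; lmod.
have [r [sr rE rC]] := pm.
have hr : ccomm h r by apply: rC.
have rn : ccomm r n.
  apply/ccommZ/ccommB; last exact: ccommC.
  by rewrite -rE /ccomm cmulA.
have : r ** n = 0.
  apply: (@starM_neg (b ** n)); first exact: saM.
  rewrite starM sn !cmulA -(cmulA n) -hE -(cmulA n h) hn cmulNr.
  by rewrite -rE !cmulA rn.
move=> rn0.
have n2 : n ** n = 0 by rewrite nn -rE -cmulA rn0 cmul0r.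
have n0 := sa_sqr_eq0 sn n2.
suff -> : h = m by [].
rewrite -[h]addr0 -(scaler0 _ 2%:C) -n0 /n; lmod.
Qed.

Lemma pos_conj a c : pos a -> pos (star c ** a ** c).
Proof.
move=> [r [sr <- _]].
rewrite cmulA -(cmulA _ r) -{1}sr -starM; exact: pos_starM.
Qed.

(** [s] is |k| k^-1. Since k = s |k|, the last bound reduces to || |k| - M / 2 || <= M / 2, which
    holds because (M / 2)^2 - (|k| - M / 2)^2 = |k| (M - |k|) is the square of a product of
    commuting roots. *)
Lemma exists_sgn k j M : selfadjoint k -> inverse k j -> nr k <= M -> 0 < M ->
  exists s, [/\ selfadjoint s, s ** s = e, pos (s ** k), bicomm k s &
    nr (k - (M / 2)%:C *: s) <= M / 2].
Proof.
move=> sk inv_k kM M0.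
have sj := inverse_sa eP sk inv_k.
have jC := inverse_bicomm eP inv_k.
have [m [pm mE mC]] := exists_abs sk.
have mC' : bicomm k m by move=> c ck; apply/mC/ccommM.
have jm : ccomm j m by apply/mC'/ccommC/jC.
have sm := pos_sa pm.
have [kj jk] := inv_k.
have sE : m ** j ** (m ** j) = e.
  rewrite cmulA -(cmulA m) jm cmulA mE -cmulA -(cmulA k) (cmulA k j) kj.
  by rewrite (cmul1l eP).
have ss : selfadjoint (m ** j) by apply: saM => //; apply: ccommC.
have s1 : nr (m ** j) <= 1.
  rewrite -(@ler_pXn2r _ 2)// ?nnegrE ?nr_ge0// expr1n -nr_sa_sqr// sE.
  exact: nr1_le.
exists (m ** j); split => //.
- by rewrite -cmulA jk (cmul1r eP).
- by move=> c ck; apply: ccommM; [exact: mC'|exact: jC].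
have mM : nr m <= M.
  rewrite -(@ler_pXn2r _ 2)// ?nnegrE ?nr_ge0 ?(ltW M0)// -nr_sa_sqr// mE.
  by rewrite nr_sa_sqr// lerXn2r ?nnegrE ?nr_ge0 ?(ltW M0).
have -> : k - (M / 2)%:C *: (m ** j) = m ** j ** (m - (M / 2)%:C *: e).
  ncexpand; rewrite ?(cmul1r eP) -(cmulA m) jm cmulA mE -(cmulA k) kj.
  by rewrite (cmul1r eP).
rewrite -[leRHS]mul1r; apply: nrM_le => //.
have [r [sr rE rC]] := pm.
have [t [st tE tC]] := pos_sub eP pm mM.
have rm : ccomm r m by rewrite -rE /ccomm cmulA.
have tr : ccomm r t.
  by apply: tC; apply: ccommB => //; apply/ccommZ/ccomm1.
have tm : ccomm t m by rewrite -rE; apply: ccommM; apply: ccommC.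
have M20 : 0 <= M / 2 by rewrite divr_ge0// ltW.
rewrite -(@ler_pXn2r _ 2)// ?nnegrE ?nr_ge0//.
apply: (@sqr_sum_le _ _ e eP (r ** t)).
- exact: saM.
- by apply: saB => //; apply/saZ/sa1.
- apply: ccommB; last by apply/ccommZ/ccomm1.
  by rewrite -rE; apply: ccommM; apply/ccommC; apply: ccommM => //;
    apply/ccommC.
- have -> : r ** t ** (r ** t) = m ** (M%:C *: e - m).
    by rewrite cmulA -(cmulA r) -tr cmulA rE -tE cmulA.
  by nc.
- exact: exprn_ge0.
Qed.

End UnitalOrder.

(** A Cauchy filter is followed by points u n whose ball of radius 1 / (n + 1) belongs to it. This
    passes from sequences to the filter form of completeness, for the instance on multipliers. *)
Lemma nr_complete_cvg (R : realType) (V : normedModType R[i]) :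
  (forall u : nat -> V,
    (forall e : R, 0 < e -> exists N, forall n m, (N <= n)%N -> (N <= m)%N ->
      nr (u n - u m) < e) -> exists l, tends u l) ->
  forall F : set_system V, ProperFilter F -> cauchy F -> cvg F.
Proof.
move=> Vc F FF /cauchyP FC.
have /choice [u uF] : forall n : nat, exists x : V,
    F (fun y => nr (x - y) < n.+1%:R^-1).
  move=> n; have /FC [x Fx] : 0 < (n.+1%:R^-1)%:C :> R[i].
    by rewrite ltcR invr_gt0 ltr0n.
  exists x; apply: filterS Fx => y.
  by rewrite -ball_normE /ball_ /= nrE ltcR.
have inv_small (e : R) : 0 < e -> exists N, forall n, (N <= n)%N ->
    n.+1%:R^-1 < e.
  move=> e0; exists (Num.truncn e^-1) => n Nn.
  rewrite -ltf_pV2 ?posrE ?invr_gt0// invrK.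
  by apply: lt_le_trans (truncnS_gt _) _; rewrite ler_nat ltnS.
have [|l ul] := Vc u.
- move=> e e0; have [|N hN] := inv_small (e / 2); first by rewrite divr_gt0.
  exists N => n m /hN h1 /hN h2.
  have [y [/= y1]] := filter_ex (filterI (uF n) (uF m)).
  rewrite nr_dist => y2; have d1 := lt_trans y1 h1; have d2 := lt_trans y2 h2.
  by apply: le_lt_trans (nr_dist_triangle y _ _) _; lra.
apply/cvg_ex; exists l; apply/cvgrPdist_lt => e e0.
have e0' : 0 < complex.Re e by case: e e0 => a b; rewrite ltcE => /andP[].
have eE : e = (complex.Re e)%:C.
  by move: e0; case: e {e0'} => a b; rewrite ltcE /= => /andP[/eqP -> _].
have [|N hN] := inv_small (complex.Re e / 2); first by rewrite divr_gt0.
have [|M hM] := ul (complex.Re e / 2); first by rewrite divr_gt0.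
apply: filterS (uF (maxn N M)) => y h.
rewrite nrE eE ltcR.
have := hN _ (leq_maxl N M); have := hM _ (leq_maxr N M);
  rewrite nr_dist => h1 h2.
have d := lt_trans h h2.
by apply: le_lt_trans (nr_dist_triangle (u (maxn N M)) _ _) _; lra.
Qed.

(** * The multiplier algebra as a unital C*-algebra *)

Section MultiplierAlgebra.
Variables (R : realType) (A : cstarAlgType R).
Implicit Types (a b c : A) (u v w : multiplier A) (k : R[i]).

Lemma cmulr_eq0 a : (forall b, a ** b = 0) -> a = 0.
Proof.
by move=> h; rewrite -(starK a) (starM_eq0 (a := star a)) ?star0// starK h.
Qed.

Lemma cmull_eq0 a : (forall b, b ** a = 0) -> a = 0.
Proof. by move=> h; apply: starM_eq0. Qed.

(** The left action determines the right one through [mleft_right], because an element annihilating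
    A is 0. Identities between multipliers are hence checked on the left only. *)
Lemma multiplier_eql u v : mleft u =1 mleft v -> u = v.
Proof.
move=> uv; apply: multiplier_eq => // a; apply/eqP; rewrite -subr_eq0;
  apply/eqP.
apply: cmulr_eq0 => b.
by rewrite cmulDl cmulNl -!mleft_right uv subrr.
Qed.

Lemma mleftD u a b : mleft u (a + b) = mleft u a + mleft u b.
Proof. by have := mleft_linear u 1 a b; rewrite !scale1r. Qed.

Lemma mleft0 u : mleft u 0 = 0.
Proof. by apply: (addrI (mleft u 0)); rewrite -mleftD !addr0. Qed.

Lemma mleftZ u k a : mleft u (k *: a) = k *: mleft u a.
Proof. by have := mleft_linear u k a 0; rewrite mleft0 !addr0. Qed.

Lemma mrightD u a b : mright u (a + b) = mright u a + mright u b.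
Proof. by have := mright_linear u 1 a b; rewrite !scale1r. Qed.

Lemma mright0 u : mright u 0 = 0.
Proof. by apply: (addrI (mright u 0)); rewrite -mrightD !addr0. Qed.

Lemma mrightZ u k a : mright u (k *: a) = k *: mright u a.
Proof. by have := mright_linear u k a 0; rewrite mright0 !addr0. Qed.

Lemma bounded_op_real (V W : normedModType R[i]) (f : V -> W) :
  bounded_op f <-> exists2 M : R, 0 <= M & forall x, nr (f x) <= M * nr x.
Proof.
split=> [[M fM]|[M M0 fM]]; last first.
  by exists M => x; rewrite !nrE -rmorphM lecR.
exists `|M| => // x; have := fM x; rewrite !nrE -rmorphM lecR => h.
by apply: le_trans h _; rewrite ler_wpM2r ?nr_ge0// ler_norm.
Qed.

Program Definition mult_add u v : multiplier A :=
  @Multiplier _ _ (fun a => mleft u a + mleft v a)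
    (fun a => mright u a + mright v a) _ _ _ _ _ _ _.
Next Obligation.
by move=> u v k a b; rewrite /= !mleftD !mleftZ scalerDr addrACA.
Qed.
Next Obligation.
by move=> u v k a b; rewrite /= !mrightD !mrightZ scalerDr addrACA.
Qed.
Next Obligation.
move=> u v; have /bounded_op_real [M M0 uM] := mleft_bounded u.
have /bounded_op_real [N N0 vN] := mleft_bounded v.
apply/bounded_op_real; exists (M + N); first exact: addr_ge0.
by move=> a; apply: le_trans (nrD _ _) _; rewrite mulrDl lerD.
Qed.
Next Obligation.
move=> u v; have /bounded_op_real [M M0 uM] := mright_bounded u.
have /bounded_op_real [N N0 vN] := mright_bounded v.
apply/bounded_op_real; exists (M + N); first exact: addr_ge0.
by move=> a; apply: le_trans (nrD _ _) _; rewrite mulrDl lerD.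
Qed.
Next Obligation. by move=> u v a b; rewrite /= !mleftM cmulDl. Qed.
Next Obligation. by move=> u v a b; rewrite /= !mrightM cmulDr. Qed.
Next Obligation. by move=> u v a b; rewrite /= cmulDr cmulDl !mleft_right. Qed.

Program Definition mult_scale k u : multiplier A :=
  @Multiplier _ _ (fun a => k *: mleft u a) (fun a => k *: mright u a)
    _ _ _ _ _ _ _.
Next Obligation.
by move=> k u k' a b; rewrite /= mleftD mleftZ scalerDr !scalerA mulrC.
Qed.
Next Obligation.
by move=> k u k' a b; rewrite /= mrightD mrightZ scalerDr !scalerA mulrC.
Qed.
Next Obligation.
move=> k u; have /bounded_op_real [M M0 uM] := mleft_bounded u.
have k0 : 0 <= complex.Re `|k| by have := nr_ge0 (k : R[i]^o); apply: le_trans.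
apply/bounded_op_real; exists (complex.Re `|k| * M); first exact: mulr_ge0.
by move=> a; rewrite nrZ -mulrA ler_wpM2l.
Qed.
Next Obligation.
move=> k u; have /bounded_op_real [M M0 uM] := mright_bounded u.
have k0 : 0 <= complex.Re `|k| by have := nr_ge0 (k : R[i]^o); apply: le_trans.
apply/bounded_op_real; exists (complex.Re `|k| * M); first exact: mulr_ge0.
by move=> a; rewrite nrZ -mulrA ler_wpM2l.
Qed.
Next Obligation. by move=> k u a b; rewrite /= mleftM cmulZl. Qed.
Next Obligation. by move=> k u a b; rewrite /= mrightM cmulZr. Qed.
Next Obligation. by move=> k u a b; rewrite /= cmulZl cmulZr mleft_right. Qed.

Program Definition mult_zero : multiplier A :=
  @Multiplier _ _ (fun=> 0) (fun=> 0) _ _ _ _ _ _ _.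
Next Obligation. by move=> k a b; rewrite /= scaler0 addr0. Qed.
Next Obligation. by move=> k a b; rewrite /= scaler0 addr0. Qed.
Next Obligation. by exists 0 => a; rewrite normr0 mul0r. Qed.
Next Obligation. by exists 0 => a; rewrite normr0 mul0r. Qed.
Next Obligation. by move=> a b; rewrite /= cmul0l. Qed.
Next Obligation. by move=> a b; rewrite /= cmul0r. Qed.
Next Obligation. by move=> a b; rewrite /= cmul0r cmul0l. Qed.

Program Definition mult_one : multiplier A :=
  @Multiplier _ _ id id _ _ _ _ _ _ _.
Solve Obligations with by [].
Next Obligation. by exists 1 => a; rewrite mul1r. Qed.
Next Obligation. by exists 1 => a; rewrite mul1r. Qed.

Program Definition mult_of a : multiplier A :=
  @Multiplier _ _ (fun b => a ** b) (fun b => b ** a) _ _ _ _ _ _ _.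
Next Obligation. by move=> a k b c; rewrite /= cmulDr cmulZr. Qed.
Next Obligation. by move=> a k b c; rewrite /= cmulDl cmulZl. Qed.
Next Obligation.
move=> a; apply/bounded_op_real; exists (nr a); first exact: nr_ge0.
by move=> b; apply: nrM.
Qed.
Next Obligation.
move=> a; apply/bounded_op_real; exists (nr a); first exact: nr_ge0.
by move=> b; rewrite mulrC; apply: nrM.
Qed.
Next Obligation. by move=> a b c; rewrite /= cmulA. Qed.
Next Obligation. by move=> a b c; rewrite /= cmulA. Qed.
Next Obligation. by move=> a b c; rewrite /= cmulA. Qed.

HB.instance Definition _ := gen_eqMixin (multiplier A).
HB.instance Definition _ := gen_choiceMixin (multiplier A).

Lemma mult_addA : associative mult_add.
Proof. by move=> u v w; apply: multiplier_eql => a /=; rewrite addrA. Qed.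
Lemma mult_addC : commutative mult_add.
Proof. by move=> u v; apply: multiplier_eql => a /=; rewrite addrC. Qed.
Lemma mult_add0 : left_id mult_zero mult_add.
Proof. by move=> u; apply: multiplier_eql => a /=; rewrite add0r. Qed.
Lemma mult_addN : left_inverse mult_zero (mult_scale (-1)) mult_add.
Proof. by move=> u; apply: multiplier_eql => a /=; rewrite scaleN1r addNr. Qed.

HB.instance Definition _ := GRing.isZmodule.Build (multiplier A)
  mult_addA mult_addC mult_add0 mult_addN.

Lemma mult_scaleA k k' u :
  mult_scale k (mult_scale k' u) = mult_scale (k * k') u.
Proof. by apply: multiplier_eql => a /=; rewrite scalerA. Qed.
Lemma mult_scale1 : left_id 1 mult_scale.
Proof. by move=> u; apply: multiplier_eql => a /=; rewrite scale1r. Qed.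
Lemma mult_scaleDr : right_distributive mult_scale +%R.
Proof. by move=> k u v; apply: multiplier_eql => a /=; rewrite scalerDr. Qed.
Lemma mult_scaleDl u : {morph mult_scale^~ u : k k' / k + k'}.
Proof. by move=> k k'; apply: multiplier_eql => a /=; rewrite scalerDl. Qed.

HB.instance Definition _ := GRing.Zmodule_isLmodule.Build R[i] (multiplier A)
  mult_scaleA mult_scale1 mult_scaleDr mult_scaleDl.

Lemma mleft_add u v a : mleft (u + v) a = mleft u a + mleft v a.
Proof. by []. Qed.
Lemma mleft_scale k u a : mleft (k *: u) a = k *: mleft u a.
Proof. by []. Qed.
Lemma mright_add u v a : mright (u + v) a = mright u a + mright v a.
Proof. by []. Qed.
Lemma mleft_opp u a : mleft (- u) a = - mleft u a.
Proof. by rewrite -scaleN1r mleft_scale scaleN1r. Qed.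
Lemma mright_opp u a : mright (- u) a = - mright u a.
Proof. by rewrite -scaleN1r [LHS]/= scaleN1r. Qed.

(** Only the left action is measured; invariance under the adjoint, [nr_mult_star], makes the same
    norm bound the right action. *)
Definition mnorm u : R := sup [set nr (mleft u a) | a in [set a | nr a <= 1]].

Lemma mnorm_has_sup u : has_sup [set nr (mleft u a) | a in [set a | nr a <= 1]].
Proof.
split; first by exists (nr (mleft u 0)), 0 => //=; rewrite nr0 ler01.
have /bounded_op_real [M M0 uM] := mleft_bounded u.
by exists M => _ [a /= a1 <-]; apply: le_trans (uM a) _; rewrite ler_piMr.
Qed.

Lemma mnorm_ge0 u : 0 <= mnorm u.
Proof.
apply: le_trans (nr_ge0 (mleft u 0)) _;
  apply: sup_upper_bound (mnorm_has_sup u) _ _.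
by exists 0 => //=; rewrite nr0 ler01.
Qed.

Lemma mnormP u a : nr (mleft u a) <= mnorm u * nr a.
Proof.
have [/nr0_eq0 ->|a0] := eqVneq (nr a) 0; first by rewrite mleft0 nr0 mulr0.
have a_gt0 : 0 < nr a by rewrite lt_neqAle eq_sym a0 nr_ge0.
rewrite -ler_pdivrMr// mulrC.
rewrite -[X in X * _](@ger0_norm _ (nr a)^-1) ?invr_ge0 ?nr_ge0//.
rewrite -nrZr -mleftZ; apply: sup_upper_bound (mnorm_has_sup u) _ _.
exists (((nr a)^-1)%:C *: a) => //=.
by rewrite nrZr ger0_norm ?invr_ge0 ?nr_ge0// mulVf.
Qed.

Lemma mnorm_le u (M : R) :
  0 <= M -> (forall a, nr (mleft u a) <= M * nr a) -> mnorm u <= M.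
Proof.
move=> M0 h; apply: ge_sup; first by case: (mnorm_has_sup u).
by move=> _ [a /= a1 <-]; apply: le_trans (h a) _; rewrite ler_piMr.
Qed.

Let mnormC u : R[i] := (mnorm u)%:C.

Let mnormCD u v : mnormC (u + v) <= mnormC u + mnormC v.
Proof.
rewrite -rmorphD lecR; apply: mnorm_le; first by rewrite addr_ge0 ?mnorm_ge0.
move=> a; apply: le_trans (nrD _ _) _.
by rewrite mulrDl lerD// mnormP.
Qed.

Let mnormZ_le k u : mnorm (k *: u) <= complex.Re `|k| * mnorm u.
Proof.
have k0 : 0 <= complex.Re `|k| by have := nr_ge0 (k : R[i]^o); apply: le_trans.
apply: mnorm_le; first by rewrite mulr_ge0 ?mnorm_ge0.
by move=> a; rewrite mleft_scale nrZ -mulrA ler_wpM2l// mnormP.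
Qed.

Let mnormCZ k u : mnormC (k *: u) = `|k| * mnormC u.
Proof.
have kE : `|k| = (complex.Re `|k|)%:C by exact: (nrE (k : R[i]^o)).
rewrite kE -rmorphM; congr (_%:C).
have [->|k0] := eqVneq k 0.
  apply/eqP; rewrite eq_le mnormZ_le normr0 mul0r mnorm_ge0//.
apply/eqP; rewrite eq_le mnormZ_le/=.
have rk0 : 0 < complex.Re `|k|.
  by rewrite -ltcR -kE normr_gt0.
rewrite -ler_pdivlMl//.
have := mnormZ_le k^-1 (k *: u); rewrite scalerA mulVf// scale1r normfV.
by rewrite {1}kE -fmorphV.
Qed.

Let mnormC_eq0 u : mnormC u = 0 -> u = 0.
Proof.
move=> /complexI u0; apply: multiplier_eql => a /=; apply: nr0_eq0.
by apply/eqP; rewrite eq_le nr_ge0 andbT (le_trans (mnormP u a))// u0 mul0r.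
Qed.

HB.instance Definition _ := Lmodule_isNormed.Build R[i] (multiplier A)
  mnormCD mnormCZ mnormC_eq0.

Lemma nr_mnorm u : nr u = mnorm u. Proof. by []. Qed.

Lemma nr_mleft u a : nr (mleft u a) <= nr u * nr a. Proof. exact: mnormP. Qed.

Lemma nr_mult_le u (M : R) :
  0 <= M -> (forall a, nr (mleft u a) <= M * nr a) -> nr u <= M.
Proof. exact: mnorm_le. Qed.

Lemma nr_multM u v : nr (mult_mul u v) <= nr u * nr v.
Proof.
apply: nr_mult_le => [|a]; first by rewrite mulr_ge0 ?nr_ge0.
apply: le_trans (nr_mleft u _) _.
by rewrite -mulrA ler_wpM2l ?nr_ge0// nr_mleft.
Qed.

(** ||u a||^2 is the norm of a^* (u^* u a). This half of the C*-identity already forces ||u^*|| =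
    ||u||, from which the other half follows. *)
Lemma nr_sqr_le_star u : nr u ^+ 2 <= nr (mult_mul (mult_star u) u).
Proof.
set M := nr _; rewrite -[leRHS]sqr_sqrtr ?nr_ge0//.
rewrite lerXn2r ?nnegrE ?nr_ge0 ?sqrtr_ge0//.
apply: nr_mult_le; first exact: sqrtr_ge0.
move=> a; rewrite -(@ler_pXn2r _ 2)// ?nnegrE ?nr_ge0 ?mulr_ge0 ?sqrtr_ge0
  ?nr_ge0//.
rewrite exprMn sqr_sqrtr ?nr_ge0// -nr_starM.
have -> : star (mleft u a) ** mleft u a =
    star a ** mleft (mult_mul (mult_star u) u) a.
  by rewrite [RHS](mleft_right (mult_star u)) /= starK.
apply: le_trans (nrM _ _) _; rewrite nr_star mulrC expr2 mulrA.
by rewrite ler_wpM2r ?nr_ge0// nr_mleft.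
Qed.

Lemma mult_starK u : mult_star (mult_star u) = u.
Proof. by apply: multiplier_eql => a /=; rewrite !starK. Qed.

Lemma nr_mult_star u : nr (mult_star u) = nr u.
Proof.
have le_star v : nr v <= nr (mult_star v).
  have [->|v0] := eqVneq (nr v) 0; first exact: nr_ge0.
  rewrite -(ler_pM2r (x := nr v)); last by rewrite lt_neqAle eq_sym v0 nr_ge0.
  by rewrite -expr2; apply: le_trans (nr_sqr_le_star v) (nr_multM _ _).
by apply/eqP; rewrite eq_le le_star andbT -{2}(mult_starK u) le_star.
Qed.

Lemma nr_mright u a : nr (mright u a) <= nr u * nr a.
Proof.
rewrite -(nr_mult_star u) -(nr_star a) -nr_star.
by rewrite -{1}(starK a); apply: nr_mleft (mult_star u) _.
Qed.

Let mult_complete (F : set_system (multiplier A)) :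
  ProperFilter F -> cauchy F -> cvg F.
Proof.
move: F; apply: nr_complete_cvg => u uC.
have distL n m a : nr (mleft (u n) a - mleft (u m) a) <= nr (u n - u m) * nr a.
  by have := nr_mleft (u n - u m) a; rewrite mleft_add mleft_opp.
have distR n m a :
    nr (mright (u n) a - mright (u m) a) <= nr (u n - u m) * nr a.
  by have := nr_mright (u n - u m) a; rewrite mright_add mright_opp.
have cvgE (f : nat -> A) (C : R) :
    (forall n m, nr (f n - f m) <= nr (u n - u m) * C) -> exists l, tends f l.
  move=> fC; apply: nr_complete => e e0.
  have C1 : 0 < `|C| + 1 by apply: ltr_wpDl.
  have [|N hN] := uC (e / (`|C| + 1)); first by rewrite divr_gt0.
  exists N => n m Nn Nm; apply: le_lt_trans (fC n m) _.
  have := hN n m Nn Nm; rewrite ltr_pdivlMr//; apply: le_lt_trans.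
  rewrite ler_wpM2l ?nr_ge0//; have := ler_norm C; lra.
have /choice [l ul] : forall a, exists b, tends (fun n => mleft (u n) a) b.
  by move=> a; apply: (cvgE _ (nr a)) => n m; apply: distL.
have /choice [r ur] : forall a, exists b, tends (fun n => mright (u n) a) b.
  by move=> a; apply: (cvgE _ (nr a)) => n m; apply: distR.
have [N uN] := uC 1 ltr01.
have uM n : nr (u (n + N)%N) <= nr (u N) + 1.
  apply: le_trans (nr_le_dist _ (u N)) _; rewrite lerD2l ltW//.
  by apply: uN => //; rewrite leq_addl.
have shift (f : nat -> A) b : tends f b -> tends (fun n => f (n + N)%N) b.
  by move=> h e /h [M hM]; exists M => n Mn; apply: hM;
    rewrite (leq_trans Mn)// leq_addr.
have M0 : 0 <= nr (u N) + 1 by rewrite addr_ge0 ?nr_ge0.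
have l_lin : linear l.
  move=> k a b; apply: (tends_unique (ul _)).
  apply: tends_ext (tendsD (tendsZ k (ul a)) (ul b)) => n.
  by rewrite mleft_linear.
have r_lin : linear r.
  move=> k a b; apply: (tends_unique (ur _)).
  apply: tends_ext (tendsD (tendsZ k (ur a)) (ur b)) => n.
  by rewrite mright_linear.
have l_bnd : bounded_op l.
  apply/bounded_op_real; exists (nr (u N) + 1) => // a.
  apply: (tends_le (shift _ _ (ul a))) => n.
  by apply: le_trans (nr_mleft _ _) _; rewrite ler_wpM2r ?nr_ge0.
have r_bnd : bounded_op r.
  apply/bounded_op_real; exists (nr (u N) + 1) => // a.
  apply: (tends_le (shift _ _ (ur a))) => n.
  by apply: le_trans (nr_mright _ _) _; rewrite ler_wpM2r ?nr_ge0.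
have lM a b : l (a ** b) = l a ** b.
  apply: (tends_unique (ul _)).
  by apply: tends_ext (tendsMr b (ul a)) => n; rewrite mleftM.
have rM a b : r (a ** b) = a ** r b.
  apply: (tends_unique (ur _)).
  by apply: tends_ext (tendsMl a (ur b)) => n; rewrite mrightM.
have lr a b : a ** l b = r a ** b.
  apply: (tends_unique (tendsMl a (ul b))).
  by apply: tends_ext (tendsMr b (ur a)) => n; rewrite mleft_right.
exists (Multiplier l_lin r_lin l_bnd r_bnd lM rM lr) => e e0.
have [|K hK] := uC (e / 2); first by rewrite divr_gt0.
exists K => n Kn; apply: (@le_lt_trans _ _ (e / 2)); last by lra.
apply: nr_mult_le => [|a]; first by rewrite divr_ge0// ltW.
rewrite mleft_add mleft_opp /=.
have h := tendsB (tends_cst (mleft (u n) a)) (ul a).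
have h' : tends (fun m => mleft (u n) a - mleft (u (m + K)%N) a)
    (mleft (u n) a - l a).
  by move=> d /h [M hM]; exists M => m Mm; apply: hM;
    rewrite (leq_trans Mm)// leq_addr.
apply: (tends_le h') => m; apply: le_trans (distL _ _ _) _.
by rewrite ler_wpM2r ?nr_ge0// ltW// hK// leq_addl.
Qed.

HB.instance Definition _ := Uniform_isComplete.Build (multiplier A)
  mult_complete.

Definition mult_cstar : isCStarAlgebra R (multiplier A).
Proof.
apply: (@isCStarAlgebra.Build R (multiplier A)
  (@mult_mul R A) (@mult_star R A)).
- by move=> u v w; apply: multiplier_eql.
- by move=> u v w; apply: multiplier_eql.
- by move=> u v w; apply: multiplier_eql => a /=; rewrite mleftD.
- by move=> k u v; apply: multiplier_eql.
- by move=> k u v; apply: multiplier_eql => a /=; rewrite mleftZ.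
- by move=> u v; apply: multiplier_eql => a /=; rewrite starD.
- by move=> k u; apply: multiplier_eql => a /=; rewrite starZ.
- by move=> u v; apply: multiplier_eql => a /=; rewrite starK.
- exact: mult_starK.
- by move=> u v; rewrite !nrE -rmorphM lecR; apply: nr_multM.
- move=> u; rewrite !nrE -rmorphXn/=; congr (_%:C).
  apply/eqP; rewrite eq_le nr_sqr_le_star andbT expr2.
  by rewrite -{1}(nr_mult_star u) nr_multM.
Defined.
HB.instance Definition _ := mult_cstar.

End MultiplierAlgebra.

(** * A as an ideal of M(A) *)

Section IdealEmbedding.
Variables (R : realType) (A : cstarAlgType R).
Implicit Types (a b c : A) (u v : multiplier A).

Lemma mult_one_unit : is_unit_elt (mult_one A).
Proof. by move=> u; split; apply: multiplier_eql => a. Qed.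

Lemma mult_of_mul a b : mult_of (a ** b) = mult_of a ** mult_of b.
Proof. by apply: multiplier_eql => c /=; rewrite cmulA. Qed.

Lemma mult_of_mull u a : u ** mult_of a = mult_of (mleft u a).
Proof. by apply: multiplier_eql => c /=; rewrite mleftM. Qed.

Lemma mult_of_mulr u a : mult_of a ** u = mult_of (mright u a).
Proof. by apply: multiplier_eql => c /=; rewrite mleft_right. Qed.

Lemma mult_of_add a b : mult_of (a + b) = mult_of a + mult_of b.
Proof. by apply: multiplier_eql => c /=; rewrite cmulDl. Qed.

Lemma mult_of_scale (k : R[i]) a : mult_of (k *: a) = k *: mult_of a.
Proof. by apply: multiplier_eql => c /=; rewrite cmulZl. Qed.

Lemma mult_of_opp a : mult_of (- a) = - mult_of a.
Proof. by rewrite -scaleN1r mult_of_scale scaleN1r. Qed.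

Lemma mult_of_sub a b : mult_of (a - b) = mult_of a - mult_of b.
Proof. by rewrite mult_of_add mult_of_opp. Qed.

Lemma mult_of_star a : mult_of (star a) = star (mult_of a).
Proof. by apply: multiplier_eql => c /=; rewrite starM starK. Qed.

Lemma mult_of_inj : injective (@mult_of R A).
Proof.
move=> a b ab; apply/eqP; rewrite -subr_eq0; apply/eqP.
apply: cmulr_eq0 => c; have := congr1 (fun u => mleft u c) ab => /= h.
by rewrite cmulDl cmulNl h subrr.
Qed.

Lemma nr_mult_of a : nr (mult_of a) = nr a.
Proof.
apply/eqP; rewrite eq_le; apply/andP; split.
  by apply: nr_mult_le; [exact: nr_ge0|move=> b; exact: nrM].
have [->|a0] := eqVneq (nr a) 0; first exact: nr_ge0.
have a_gt0 : 0 < nr a by rewrite lt_neqAle eq_sym a0 nr_ge0.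
rewrite -(ler_pM2r a_gt0) -expr2 -(nr_star a) -nr_starM starK.
exact: (nr_mleft (mult_of a)).
Qed.

Lemma mult_of_sa a : selfadjoint a -> selfadjoint (mult_of a).
Proof. by rewrite /selfadjoint -mult_of_star => ->. Qed.

(** Merges the two clauses of real rank zero. In the unital case the unit of A is that of M(A);
    otherwise the unitization maps into M(A), and [unitz_norm] is the multiplier norm. *)
Lemma real_rank_zero_mult (A0 : real_rank_zero A) (h : A) (l r : R) :
  selfadjoint h -> 0 < r -> exists k j : multiplier A,
  [/\ selfadjoint k, inverse (mult_one A) k j &
      nr (mult_of h + l%:C *: mult_one A - k) < r].
Proof.
move=> sh r0; case: A0 => A1 A2.
have [uA|nuA] := pselect (unital A).
  have [e0 e0P] := uA.
  have e01 : mult_of e0 = mult_one A.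
    by apply: multiplier_eql => c /=; case: (e0P c).
  have se : selfadjoint (h + l%:C *: e0).
    by apply: saD => //; apply: saZ; exact: star1 e0P.
  have [b [sb [c [f [fP bc cb]]] br]] := A1 uA _ se r r0.
  have fe : f = e0 by case: (fP e0) => _ <-; case: (e0P f).
  exists (mult_of b), (mult_of c); split.
  - exact: mult_of_sa.
  - by split; rewrite -mult_of_mul -e01 -fe ?bc ?cb.
  - rewrite -e01 -mult_of_scale -mult_of_add -mult_of_sub nr_mult_of.
    by move: br; rewrite nrE ltcR.
have sp : unitz_selfadjoint (h, l%:C).
  by congr pair; [exact: sh|exact: conjc_real].
have [[b m] [sq [[c n] [bc cb]] qr]] := A2 nuA _ sp r r0.
move: sq bc cb => [sb sm] [+ mn] [+ _] => /= bc cb.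
exists (mult_of b + m *: mult_one A), (mult_of c + n *: mult_one A); split.
- by rewrite /selfadjoint starD starZ sm -mult_of_star sb (star1 mult_one_unit).
- split; apply: multiplier_eql => d /=.
    transitivity ((b ** c + m *: c + n *: b) ** d + (m * n) *: d).
      by ncexpand; rewrite -scalerA; lmod.
    by rewrite bc mn cmul0l add0r scale1r.
  transitivity ((c ** b + n *: b + m *: c) ** d + (m * n) *: d).
    by ncexpand; rewrite (mulrC m) -scalerA; lmod.
  by rewrite cb mn cmul0l add0r scale1r.
- rewrite nr_mnorm; apply: le_lt_trans qr; apply: ge_sup.
    by case: (mnorm_has_sup (mult_of h + l%:C *: mult_one A -
      (mult_of b + m *: mult_one A))).
  move=> _ [a /= a1 <-].
  set u := mult_of h + l%:C *: mult_one A - (mult_of b + m *: mult_one A).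
  have uE d : mleft u d = (h - b) ** d + (l%:C - m) *: d.
    rewrite /u mleft_add mleft_opp /= cmulDl cmulNl scalerBl opprD.
    by rewrite addrACA.
  have S : [set complex.Re `|(h - b) ** d + (l%:C - m) *: d|
        | d in [set d : A | `|d| <= 1]]%classic
     = [set nr (mleft u d) | d in [set d | nr d <= 1]]%classic.
    apply/seteqP; split => _ [d d1 <-]; exists d; rewrite -?uE//.
      by move: d1; rewrite /= nrE -[1](rmorph1 (real_complex R)) lecR.
    by move: d1; rewrite /= nrE -[X in _ -> _ <= X](rmorph1 (real_complex R))
      lecR.
  rewrite -[X in nr X <= _]/(mleft u a).
  rewrite /unitz_norm /= S; apply: sup_upper_bound (mnorm_has_sup u) _ _.
  by exists a.
Qed.

Definition posA a := pos (mult_of a).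

Lemma cpositive_posA a : cpositive a -> posA a.
Proof.
by case=> b ->; rewrite /posA mult_of_mul mult_of_star;
  apply: (pos_starM mult_one_unit).
Qed.

End IdealEmbedding.

(** * Hilbert modules: the Cauchy-Schwarz inequality and spectral cut-downs *)

Section HilbertModules.
Variables (R : realType) (A : cstarAlgType R) (E : hilbertModType A).
Implicit Types (x y z : E) (a b c : A).

Lemma innerDl x y z : inner (x + y) z = inner x z + inner y z :> A.
Proof. by rewrite -star_inner innerDr starD !star_inner. Qed.

Lemma innerZl (k : R[i]) x y : inner (k *: x) y = conjc k *: inner x y :> A.
Proof. by rewrite -star_inner innerZr starZ star_inner. Qed.

Lemma innerNr x y : inner x (- y) = - inner x y :> A.
Proof. by rewrite -scaleN1r innerZr scaleN1r. Qed.

Lemma innerNl x y : inner (- x) y = - inner x y :> A.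
Proof. by rewrite -star_inner innerNr starN star_inner. Qed.

Lemma innerBr x y z : inner x (y - z) = inner x y - inner x z :> A.
Proof. by rewrite innerDr innerNr. Qed.

Lemma innerBl x y z : inner (x - y) z = inner x z - inner y z :> A.
Proof. by rewrite innerDl innerNl. Qed.

Lemma inner_ractl x y a : inner (ract x a) y = star a ** inner x y.
Proof. by rewrite -star_inner inner_ract starM star_inner. Qed.

Lemma inner0r x : inner x 0 = 0 :> A.
Proof. by rewrite -(scale0r 0) innerZr !scale0r. Qed.

Lemma inner0l x : inner 0 x = 0 :> A.
Proof. by rewrite -star_inner inner0r star0. Qed.

Lemma inner_sa x : selfadjoint (inner x x : A).
Proof. exact: star_inner. Qed.

Lemma nr_inner x : nr x ^+ 2 = nr (inner x x : A).
Proof. by apply: complexI; rewrite rmorphXn/= -!nrE hnormE. Qed.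

Lemma inner_eq0 x : inner x x = 0 :> A -> x = 0.
Proof.
by move=> h; apply: nr0_eq0; apply/eqP; rewrite -sqrf_eq0 nr_inner h nr0.
Qed.

Lemma posA_inner x : posA (inner x x : A).
Proof. exact/cpositive_posA/inner_ge0. Qed.

Lemma inner_ract2 x y a b :
  inner (ract x a) (ract y b) = star a ** inner x y ** b.
Proof. by rewrite inner_ract inner_ractl. Qed.

(** Put a = <x, y> and M = ||x||^2. Expanding <w, w> >= 0 for w = x a - M y, with <x, x> <= M and
    <y, y> <= ||y||^2, leaves a^* a / M <= ||y||^2. *)
Lemma cauchy_schwarz x y : nr (inner x y : A) <= nr x * nr y.
Proof.
have eP := @mult_one_unit R A; set e := mult_one A in eP.
have [x0|x0] := eqVneq (nr x) 0.
  by rewrite (nr0_eq0 x0) inner0l !nr0 mul0r.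
have xx : 0 < nr x by rewrite lt_neqAle eq_sym x0 nr_ge0.
set M := nr x ^+ 2; set N := nr y ^+ 2.
have M0 : 0 < M by rewrite exprn_gt0.
have [a aE] : exists a, a = inner x y :> A by eexists.
rewrite -aE -(@ler_pXn2r _ 2)// ?nnegrE ?mulr_ge0 ?nr_ge0// exprMn.
rewrite -/M -/N -nr_starM -ler_pdivrMl//.
have -> : M^-1 * nr (star a ** a) = nr ((M^-1)%:C *: mult_of (star a ** a)).
  by rewrite nrZr nr_mult_of ger0_norm// invr_ge0 ltW.
have pw := posA_inner (ract x a - M%:C *: y).
have pX : pos (M%:C *: e - mult_of (inner x x : A)).
  by apply: (pos_sub eP (posA_inner x)); rewrite nr_mult_of -nr_inner.
have pY : pos (N%:C *: e - mult_of (inner y y : A)).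
  by apply: (pos_sub eP (posA_inner y)); rewrite nr_mult_of -nr_inner.
have := pos_conj eP (mult_of a) pX => pXa.
apply: (pos_le eP).
- exact: sqr_ge0.
- apply: (posZ eP); first by rewrite invr_ge0 ltW.
  by rewrite mult_of_mul mult_of_star; apply: pos_starM eP _.
- have Mi : 0 <= (M ^+ 2)^-1 by rewrite invr_ge0 exprn_ge0// ltW.
  have := posD eP pY (posZ eP Mi (posD eP pw pXa)).
  congr (pos _).
  have ay : inner y x = star a by rewrite aE star_inner.
  rewrite !(innerBl, innerBr, innerZl, innerZr) conjc_real inner_ract2.
  rewrite inner_ract inner_ractl -aE ay.
  rewrite !(mult_of_sub, mult_of_scale, mult_of_mul, mult_of_star).
  ncexpand; rewrite (cmul1r eP); lmod; rewrite lt0r_neq0//.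
Qed.

Lemma nr_sub_ract x a :
  nr (x - ract x a) ^+ 2 = nr (inner x x - inner x x ** a - star a ** inner x x
    + star a ** inner x x ** a).
Proof.
rewrite nr_inner innerBl !innerBr inner_ract2 inner_ract inner_ractl.
by congr (nr _); lmod.
Qed.

(** [p] is the positive spectral projection of an invertible k within d / 2 of <x, x> - d. On it <x,
    x> is at least d / 2, so x p can be normalized inside the module; off it k is negative, so
    little of x is lost. The elements [r] and [t] normalize and restore: x p = (x r) t. *)
Lemma spectral_cut (A0 : real_rank_zero A) x (d : R) : 0 < d -> d <= 1 ->
  exists p r t : A, [/\ selfadjoint p, p ** p = p, r ** t = p,
    inner (ract x r) (ract x r) = p & nr (x - ract x p) ^+ 2 <= 2 * d].
Proof.
move=> d0 d1; have eP := @mult_one_unit R A; set e := mult_one A in eP.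
have [h hE] : exists h, h = inner x x :> A by eexists.
have sh : selfadjoint h by rewrite hE; apply: inner_sa.
have d20 : 0 < d / 2 by rewrite divr_gt0.
have [k [j0 [sk kj kd]]] := real_rank_zero_mult A0 (- d) sh d20.
have [M0 kM] : 0 < nr k + 1 /\ nr k <= nr k + 1.
  by rewrite lerDl ler01 ltr_wpDl// nr_ge0.
have [s [ss sE + ks _]] := exists_sgn eP sk kj kM M0.
have [m0 m0E] : exists m0, m0 = s ** k by eexists.
rewrite -m0E => pm0.
have sm0 : s ** m0 = k by rewrite m0E cmulA sE (cmul1l eP).
have [P PE] : exists P, P = (2^-1)%:C *: (e + s) by eexists.
have [Q QE] : exists Q, Q = (2^-1)%:C *: (e - s) by eexists.
have Ps : P ** s = P by rewrite PE; ncexpand; rewrite (cmul1l eP) sE; lmod.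
have Qs : Q ** s = - Q by rewrite QE; ncexpand; rewrite (cmul1l eP) sE; lmod.
have PP : P ** P = P by rewrite {2}PE; ncexpand; rewrite (cmul1r eP) Ps; lmod.
have PQ : P ** Q = 0 by rewrite QE; ncexpand; rewrite (cmul1r eP) Ps; lmod.
have QQ : Q ** Q = Q by rewrite {2}QE; ncexpand; rewrite (cmul1r eP) Qs; lmod.
have QP : Q ** P = 0 by rewrite PE; ncexpand; rewrite (cmul1r eP) Qs; lmod.
have eE : e = P + Q by rewrite PE QE; lmod.
have sP : selfadjoint P by rewrite PE; apply/saZ/saD => //; apply: sa1 eP.
have sQ : selfadjoint Q by rewrite QE; apply/saZ/saB => //; apply: sa1 eP.
have pQ : pos Q by rewrite -QQ -{1}sQ; apply: pos_starM.
have pP : pos P by rewrite -PP -{1}sP; apply: pos_starM.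
have [D DE] : exists D, D = mult_of h - d%:C *: e - k by eexists.
have sD : selfadjoint D.
  by rewrite DE; do 2! (apply: saB => //); [exact: mult_of_sa|apply: saZ;
    exact: sa1 eP].
have HE : mult_of h = k + d%:C *: e + D by rewrite DE; lmod.
have D2 : nr D <= d / 2.
  by move: kd; rewrite DE rmorphN scaleNr => /ltW.
have pW := pos_addr eP sD D2.
have pW' : pos ((d / 2)%:C *: e - D).
  by apply: (pos_addr eP); [exact: saN|rewrite nrN].
have pPH := pos_conj eP P (posD eP pW pm0).
have PkP : P ** k ** P = P ** m0 ** P by rewrite -sm0 cmulA Ps.
have QkQ : Q ** k ** Q = - (Q ** m0 ** Q) by rewrite -sm0 cmulA Qs !cmulNl.
rewrite sP in pPH.
(* Adding Q completes the corner P h P to an invertible of M(A). Both corners are at least d / 2: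
   the first since h = k + d + D with ||D|| <= d / 2 and P k P >= 0, the second since d <= 1. *)
have [m mE] : exists m, m = P ** mult_of h ** P + Q by eexists.
have pm : pos (m - (d / 2)%:C *: e).
  have d2 : 0 <= 1 - d / 2 by lra.
  have := posD eP pPH (posZ eP d2 pQ); congr (pos _).
  rewrite mE HE; ncexpand; rewrite (cmul1r eP) PP PkP eE.
  by ncexpand; rewrite ?PP ?PQ; lmod.
have sm : selfadjoint m.
  rewrite mE; apply: saD => //; rewrite -{1}sP; apply/sa_conj/mult_of_sa => //.
have [j mj] := pos_inverse eP d20 sm pm.
have [mj1 jm1] := mj.
have sj := inverse_sa eP sm mj.
have jC := inverse_bicomm eP mj.
have pm' : pos m.
  have -> : m = (m - (d / 2)%:C *: e) + (d / 2)%:C *: e by rewrite subrK.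
  by apply: (posD eP) => //; apply: (posZ eP); [exact: ltW|exact: pos1].
have pj : pos j.
  have := pos_conj eP j pm'; rewrite sj jm1 (cmul1l eP); exact.
have [g [sg gE gC]] := pj.
have Pm : P ** m = P ** mult_of h ** P.
  by rewrite mE cmulDr PQ addr0 !cmulA PP.
have mP : ccomm P m.
  by rewrite /ccomm Pm mE cmulDl QP addr0 -!cmulA PP.
have Pj : ccomm P j by apply: jC.
have Pg : ccomm P g by apply: gC.
have gm : ccomm m g by apply: gC; apply: jC.
(* P equals P h P j, which lies in A since h does. *)
pose p := mright j (mright P (mleft P h)).
have pE : mult_of p = P.
  rewrite /p -!mult_of_mulr -mult_of_mull -Pm -cmulA mj1.
  by rewrite (cmul1r eP).
(* g is a root of j commuting with P and m, so r^* h r = g P h P g = P and r t = P j m = P. *)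
pose r := mright g p; pose t := mright (g ** m) p.
have rE : mult_of r = P ** g by rewrite /r -mult_of_mulr pE.
have tE : mult_of t = P ** g ** m by rewrite /t -mult_of_mulr pE cmulA.
exists p, r, t; split.
- by apply: mult_of_inj; rewrite mult_of_star pE.
- by apply: mult_of_inj; rewrite mult_of_mul pE.
- apply: mult_of_inj; rewrite mult_of_mul rE tE pE !cmulA -(cmulA P g P) -Pg.
  by rewrite cmulA PP -(cmulA P g) gE -cmulA jm1 (cmul1r eP).
- apply: mult_of_inj; rewrite inner_ract2 -hE !mult_of_mul mult_of_star rE pE.
  rewrite starM sP sg !cmulA -(cmulA g P) -(cmulA g) -Pm cmulA -Pg.
  by rewrite -(cmulA P) -gm cmulA -cmulA gE -cmulA mj1 (cmul1r eP).
- rewrite nr_sub_ract -hE -nr_mult_of.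
  rewrite !(mult_of_add, mult_of_sub, mult_of_opp, mult_of_mul,
    mult_of_star) pE sP.
  have -> : mult_of h - mult_of h ** P - P ** mult_of h + P ** mult_of h ** P =
      Q ** mult_of h ** Q.
    have -> : Q = e - P by rewrite eE; lmod.
    by ncexpand; rewrite !(cmul1l eP, cmul1r eP); lmod.
  apply: (pos_le eP).
  + by rewrite mulr_ge0// ltW.
  + by rewrite -{1}sQ hE; apply: pos_conj => //; apply: posA_inner.
  (* On Q the element k is - m0, so 2 d - Q h Q is the sum of Q (d / 2 - D + m0) Q, (d / 2) Q and 2
     d P. *)
  + have h1 : 0 <= d / 2 by exact: ltW.
    have h2 : 0 <= 2 * d by rewrite mulr_ge0// ltW.
    have pQ' := pos_conj eP Q (posD eP pW' pm0).
    rewrite sQ in pQ'.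
    have := posD eP pQ' (posD eP (posZ eP h1 pQ) (posZ eP h2 pP)).
    congr (pos _).
    rewrite HE eE; ncexpand; rewrite ?QP ?PQ ?QQ ?PP ?QkQ ?cmul0l ?cmul0r.
    by lmod.
Qed.

End HilbertModules.

(** * Invertible elements in corners *)

Section Corner.
Variables (R : realType) (B : cstarAlgType R) (e : B).
Hypothesis eP : is_unit_elt e.

(* The Schur complement of the (1 - P)-corner of an invertible element is
   invertible; hence the real rank zero property passes to corners. *)
Lemma corner_schur (P C k0 j : B) (N : R) :
  projection P -> selfadjoint C -> P ** C = C -> C ** P = C ->
  0 < N -> nr C <= N -> selfadjoint k0 -> inverse e k0 j ->
  nr (C + N%:C *: (e - P) - k0) < N / 8 ->
  exists k g, [/\ selfadjoint k, inverse e k g, ccomm P k,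
    nr k <= 5 / 4 * N & nr (P ** k - C) <= N / 4].
Proof.
move=> [sP PP] sC PC CP N0 nC sk0 kj nk0.
have [Q QE] : exists Q, Q = e - P by eexists.
rewrite -QE in nk0.
have sQ : selfadjoint Q by rewrite QE; apply: saB => //; apply: sa1 eP.
have PQ : P ** Q = 0 by rewrite QE cmulDr cmulNr (cmul1r eP) PP subrr.
have QP : Q ** P = 0 by rewrite QE cmulDl cmulNl (cmul1l eP) PP subrr.
have QQ : Q ** Q = Q by rewrite {2}QE cmulDr cmulNr (cmul1r eP) QP subr0.
have eE : e = P + Q by rewrite QE; lmod.
have nP : nr P <= 1 by exact: nr_projection.
have nQ : nr Q <= 1 by exact: nr_projection.
have QC : Q ** C = 0 by rewrite QE cmulDl cmulNl (cmul1l eP) PC subrr.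
have CQ : C ** Q = 0 by rewrite QE cmulDr cmulNr (cmul1r eP) CP subrr.
have N8 : 0 < N / 8 by rewrite divr_gt0.
have N8' := ltW N8.
have [X XE] : exists X, X = C + N%:C *: Q by eexists.
have [D DE] : exists D, D = X - k0 by eexists.
rewrite -XE -DE in nk0; have nD := ltW nk0.
have k0E : k0 = C + N%:C *: Q - D by rewrite DE XE; lmod.
have sX : selfadjoint X by rewrite XE; apply: saD => //; apply: saZ.
have sD : selfadjoint D by rewrite DE; apply: saB.
have [kj1 jk1] := kj.
have sj := inverse_sa eP sk0 kj.
have Qk0Q : Q ** k0 ** Q = N%:C *: Q - Q ** D ** Q.
  by rewrite k0E; ncexpand; rewrite QC !QQ cmul0l; lmod.
have Pk0Q : P ** k0 ** Q = - (P ** D ** Q).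
  by rewrite k0E; ncexpand; rewrite PC PQ CQ cmul0l; lmod.
have Qk0P : Q ** k0 ** P = - (Q ** D ** P).
  by rewrite k0E; ncexpand; rewrite QC QQ QP cmul0l; lmod.
have Pk0P : P ** k0 ** P = C - P ** D ** P.
  by rewrite k0E; ncexpand; rewrite PC PQ CP cmul0l; lmod.
have nPDQ (p q : B) : nr p <= 1 -> nr q <= 1 -> nr (p ** D ** q) <= N / 8.
  move=> np nq; rewrite -[leRHS]mulr1 -[X in X * 1]mul1r.
  by do 2! (apply: nrM_le => //).
(* The Q-corner of k0, completed by N on P. It is within N / 8 of N, so its inverse f has norm at
   most 8 / (7 N). *)
have [F FE] : exists F, F = N%:C *: P + Q ** k0 ** Q by eexists.
have [||f Ff nf] := @neumann _ _ e eP F N (N / 8).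
- rewrite (_ : _ - F = Q ** D ** Q); first exact: nPDQ.
  by rewrite FE Qk0Q eE; lmod.
- by lra.
have [Ff1 fF1] := Ff.
have sF : selfadjoint F.
  by rewrite FE; apply: saD; [exact: saZ|rewrite -{1}sQ; exact: sa_conj].
have sf := inverse_sa eP sF Ff.
have PF : ccomm P F.
  by rewrite /ccomm FE; ncexpand; rewrite PQ !cmul0l -(cmulA _ Q P) QP cmul0r;
    lmod.
have Pf : ccomm P f by apply: (inverse_bicomm eP Ff).
(* Schur complement on P, completed by N on Q; its inverse g is the P-corner of the inverse of k0,
   completed by 1 / N on Q. *)
have [k kE] : exists k,
  k = P ** k0 ** P - P ** k0 ** Q ** f ** (Q ** k0 ** P) + N%:C *: Q by eexists.
have [g gE] : exists g, g = P ** j ** P + (N^-1)%:C *: Q by eexists.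
have sk : selfadjoint k.
  rewrite kE; apply: saD; last exact: saZ.
  apply: saB; first by rewrite -{1}sP; exact: sa_conj.
  have -> : P ** k0 ** Q = star (Q ** k0 ** P).
    by rewrite !starM sP sQ sk0 cmulA.
  exact: sa_conj.
have sg : selfadjoint g.
  by rewrite gE; apply: saD; [rewrite -{1}sP; exact: sa_conj|exact: saZ].
have sum_k0 a b : a ** k0 ** P ** j ** b = a ** b - a ** k0 ** Q ** j ** b.
  have -> : P = e - Q by rewrite eE; lmod.
  by ncexpand; rewrite !(cmul1r eP) -(cmulA a) kj1 (cmul1r eP); lmod.
have fX : f ** Q ** k0 ** P ** j ** P = - (Q ** j ** P).
  have -> : f ** Q ** k0 ** P ** j ** P = f ** (Q ** k0 ** P ** j ** P).
    by rewrite !cmulA.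
  rewrite sum_k0 QP sub0r cmulNr; congr (- _).
  have -> : Q ** k0 ** Q ** j ** P = F ** (Q ** j ** P).
    rewrite FE; ncexpand; rewrite PQ !cmul0l -(cmulA _ Q Q) QQ; lmod.
  by rewrite !cmulA fF1 (cmul1l eP).
have kg : k ** g = e.
  rewrite kE gE; ncexpand.
  rewrite ?QP ?PQ ?cmul0l -?(cmulA _ P P) ?PP -?(cmulA _ P Q) ?PQ ?cmul0r
    ?cmul0l.
  rewrite sum_k0.
  have -> : P ** k0 ** Q ** f ** Q ** k0 ** P ** j ** P =
      P ** k0 ** Q ** (f ** Q ** k0 ** P ** j ** P) by rewrite !cmulA.
  rewrite fX; ncexpand; rewrite -?(cmulA _ Q Q) ?QQ ?PP eE.
  by lmod; apply: lt0r_neq0.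
(* P D P contributes N / 8. The Schur correction also contributes at most N / 8, because the norm of
   P D Q f is at most 1. *)
have nkX : nr (k - X) <= N / 4.
  have -> : k - X = - (P ** D ** P) - P ** D ** Q ** f ** (Q ** D ** P).
    by rewrite kE Pk0P Pk0Q Qk0P XE; ncexpand; lmod.
  apply: le_trans (nrB _ _) _; rewrite nrN.
  have -> : N / 4 = N / 8 + N / 8 by lra.
  rewrite lerD ?nPDQ// -[leRHS]mul1r; apply: nrM_le; last exact: nPDQ.
  apply: le_trans (nrM_le (nPDQ _ _ nP nQ) nf) _.
  have -> : N - N / 8 = 7 / 8 * N by lra.
  by rewrite ler_pdivrMr ?mulr_gt0//; lra.
have nX : nr X <= N.
  rewrite -(@ler_pXn2r _ 2)// ?nnegrE ?nr_ge0 ?(ltW N0)// -nr_sa_sqr//.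
  apply: (pos_le eP); [exact/exprn_ge0/ltW|exact: pos_sqr|].
  have pC : pos ((N ^+ 2)%:C *: e - C ** C).
    apply: (pos_sub eP (pos_sqr eP sC)).
    by rewrite nr_sa_sqr// lerXn2r ?nnegrE ?nr_ge0// ltW.
  have := pos_conj eP P pC; rewrite sP; congr (pos _).
  rewrite XE; ncexpand; rewrite PC CQ QC QQ (cmul1r eP) PP -(cmulA _ C P) CP eE.
  by lmod.
exists k, g; split => //.
- split => //.
  by rewrite -{1}sg -{1}sk -starM kg (star1 eP).
- rewrite /ccomm kE; ncexpand; rewrite -?(cmulA _ P P) ?PP ?PQ ?QP.
  by rewrite -?(cmulA _ Q P) ?QP ?cmul0r ?cmul0l; lmod.
- by have := nr_le_dist k X; move: nX nkX; clear; lra.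
- have -> : P ** k - C = P ** (k - X).
    by rewrite XE; ncexpand; rewrite PC PQ; lmod.
  by rewrite -[leRHS]mul1r; apply: nrM_le.
Qed.

End Corner.

Lemma expr_small (R : realType) (q r : R) :
  0 <= q -> q < 1 -> 0 < r -> exists n, q ^+ n < r.
Proof.
move=> q0 q1 r0; have /cvgrPdist_lt/(_ r r0) :
    ((fun n => q ^+ n) @ \oo --> (0 : R))%classic.
  by apply: cvg_expr; rewrite ger0_norm.
case=> n _ /(_ n) /= h; exists n; move: (h (leqnn n)).
by rewrite sub0r normrN ger0_norm ?exprn_ge0.
Qed.

(** * Commutation with the corner p A p *)

Section CornerCommutation.
Variables (R : realType) (A : cstarAlgType R) (p d : A).
Hypothesis A0 : real_rank_zero A.
Hypothesis p_proj : projection p.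
Hypothesis pd : p ** d = d.
Hypothesis dp : d ** p = d.
Hypothesis d_zero : forall a b, a ** p ** b = 0 -> a ** d ** b = 0.
Implicit Types c : A.

(* d commutes with the symmetry p s of p A p, where s is the sign of an
   invertible k with p k close to c; subtracting (5 / 8) ||c|| p s from c
   decreases its norm by a fixed factor. *)
Lemma corner_approx c : selfadjoint c -> p ** c = c -> c ** p = c ->
  exists y : A, [/\ selfadjoint y, p ** y = y, y ** p = y, d ** y = y ** d &
    nr (c - y) <= 7 / 8 * nr c].
Proof.
move=> sc pc cp; have eP := @mult_one_unit R A; set e := mult_one A in eP.
have [/nr0_eq0 ->|c0] := eqVneq (nr c) 0.
  exists 0; rewrite !cmul0l !cmul0r subr0 nr0 mulr0; split => //; exact: star0.
have [N NE] : exists N, N = nr c by eexists.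
have N0 : 0 < N by rewrite NE lt_neqAle nr_ge0 andbT eq_sym.
rewrite -NE; case: (p_proj) => sp pp.
have [P PE] : exists P, P = mult_of p by eexists.
have sP : selfadjoint P by rewrite PE; apply: mult_of_sa.
have PP : P ** P = P by rewrite PE -mult_of_mul pp.
have P_proj : projection P by [].
have nP := nr_projection P_proj.
have [C CE] : exists C, C = mult_of c by eexists.
have sC : selfadjoint C by rewrite CE; apply: mult_of_sa.
have PC : P ** C = C by rewrite CE PE -mult_of_mul pc.
have CP : C ** P = C by rewrite CE PE -mult_of_mul cp.
have nC : nr C <= N by rewrite CE nr_mult_of NE.
(* Shifting c - N p by N 1 gives C + N (e - P), the element approximated in [corner_schur]. *)
have sh : selfadjoint (c - N%:C *: p) by apply: saB => //; apply: saZ.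
have N8 : 0 < N / 8 by rewrite divr_gt0.
have [k0 [j [sk0 kj nk0]]] := real_rank_zero_mult A0 N sh N8.
have [|k [g [sk kg Pk nk nPk]]] :=
    @corner_schur _ _ e eP P C k0 j N P_proj sC PC CP N0 nC sk0 kj.
  rewrite (_ : C + _ = mult_of (c - N%:C *: p) + N%:C *: e)//.
  by rewrite mult_of_sub mult_of_scale CE PE; lmod.
have M0 : 0 < 5 / 4 * N by rewrite mulr_gt0.
have [s [ss sE _ ks nks]] := exists_sgn eP sk kg nk M0.
have Ps : ccomm P s by apply: ks.
have sPs : selfadjoint (P ** s) by apply: saM.
have [D DE] : exists D, D = mult_of d by eexists.
have PD : P ** D = D by rewrite DE PE -mult_of_mul pd.
have DP : D ** P = D by rewrite DE PE -mult_of_mul dp.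
have PsP : P ** s ** P = P ** s by rewrite -cmulA -Ps cmulA PP.
have Pss : P ** s ** s = P by rewrite -cmulA sE (cmul1r eP).
(* For r = 1 and r = -1 the two outer factors have product 0, since (P s)^2 = P. Subtracting the two
   resulting identities removes D and P s D P s and leaves twice the commutator of D with P s. *)
have zero (r : R) : r ^+ 2 = 1 ->
    (P + r%:C *: (P ** s)) ** D ** (P - r%:C *: (P ** s)) = 0.
  move=> r1.
  have [a aE] : exists a, mult_of a = P + r%:C *: (P ** s).
    exists (p + r%:C *: mright s p).
    by rewrite mult_of_add mult_of_scale -mult_of_mulr PE.
  have [b bE] : exists b, mult_of b = P - r%:C *: (P ** s).
    exists (p - r%:C *: mright s p).
    by rewrite mult_of_sub mult_of_scale -mult_of_mulr PE.
  rewrite -aE -bE DE -!mult_of_mul d_zero.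
    by apply: multiplier_eql => x /=; rewrite cmul0l.
  apply: (@mult_of_inj R A); rewrite !mult_of_mul aE bE -PE.
  transitivity (mult_of (0 : A)); last by [].
  have -> : mult_of (0 : A) = 0 by apply: multiplier_eql => x /=;
    rewrite cmul0l.
  ncexpand; rewrite ?(PP, PsP, Pss) scalerA -rmorphM -expr2 r1.
  by rewrite scale1r; lmod.
have Ds : D ** (P ** s) = P ** s ** D.
  have PsE r : (P + r%:C *: (P ** s)) ** D ** (P - r%:C *: (P ** s)) =
      D + r%:C *: (P ** s ** D - D ** (P ** s))
      - (r ^+ 2)%:C *: (P ** s ** D ** (P ** s)).
    ncexpand; rewrite -?(cmulA _ D P) !DP ?PD -!cmulA ?DP ?PD.
    by rewrite scalerA -rmorphM -expr2; lmod.
  have h1 := zero 1 (expr1n _ _); have h2 := zero (-1) (sqrr_sign _ 1).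
  apply/esym/eqP; rewrite -subr_eq0; apply/eqP.
  transitivity ((2^-1)%:C *: (0 - 0 : multiplier A));
    last by rewrite subr0 scaler0.
  by rewrite -{1}h1 -h2 !PsE sqrrN; lmod.
(* ||k|| <= 5 N / 4 makes 5 N / 8 the best multiple of the sign; the error is 5 N / 8 from the sign
   and N / 4 from P k - C, in all 7 N / 8. *)
exists ((5 / 4 * N / 2)%:C *: mright s p).
have yE : mult_of (mright s p) = P ** s by rewrite -mult_of_mulr PE.
split.
- apply: saZ; apply: (@mult_of_inj R A); rewrite mult_of_star yE; exact: sPs.
- by rewrite cmulZr; congr (_ *: _); apply: (@mult_of_inj R A);
    rewrite mult_of_mul yE -PE cmulA PP.
- rewrite cmulZl; congr (_ *: _); apply: (@mult_of_inj R A).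
  by rewrite mult_of_mul yE -PE -cmulA -Ps cmulA PP.
- rewrite cmulZl cmulZr; congr (_ *: _); apply: (@mult_of_inj R A).
  by rewrite !mult_of_mul yE -DE Ds.
- rewrite -nr_mult_of mult_of_sub mult_of_scale yE -CE.
  have -> : C - (5 / 4 * N / 2)%:C *: (P ** s) =
      P ** (k - (5 / 4 * N / 2)%:C *: s) - (P ** k - C) by ncexpand; lmod.
  apply: le_trans (nrB _ _) _.
  have h : nr (P ** (k - (5 / 4 * N / 2)%:C *: s)) <= 1 * (5 / 4 * N / 2).
    exact: nrM_le.
  by move: h nPk; lra.
Qed.

(** Subtracting from [c] the approximant, which commutes with [d], leaves the commutator unchanged
    and shrinks the norm by 7 / 8; iterating forces the commutator to 0. *)
Lemma corner_commutator c : selfadjoint c -> p ** c = c -> c ** p = c ->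
  d ** c = c ** d.
Proof.
move=> sc pc cp.
have bound n : forall c, selfadjoint c -> p ** c = c -> c ** p = c ->
    nr (d ** c - c ** d) <= 2 * nr d * (7 / 8) ^+ n * nr c.
  elim: n => [|n IHn] c' sc' pc' cp'.
    rewrite expr0 mulr1; apply: le_trans (nrB _ _) _.
    by have h1 := nrM d c'; have h2 := nrM c' d; lra.
  have [y [sy py yp dy ny]] := corner_approx sc' pc' cp'.
  have -> : d ** c' - c' ** d = d ** (c' - y) - (c' - y) ** d.
    by ncexpand; rewrite dy; lmod.
  apply: le_trans (IHn _ (saB sc' sy) _ _) _.
  - by rewrite cmulDr cmulNr pc' py.
  - by rewrite cmulDl cmulNl cp' yp.
  have -> : 2 * nr d * (7 / 8) ^+ n.+1 * nr c' =
      2 * nr d * (7 / 8) ^+ n * (7 / 8 * nr c') by rewrite exprSr; ring.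
  rewrite ler_wpM2l//.
  by rewrite !mulr_ge0 ?nr_ge0// exprn_ge0.
apply/eqP; rewrite -subr_eq0; apply/eqP.
apply: (@nr_small_eq0 _ _ (2 * nr d * nr c)) => r r0.
have [|||n nr7] := @expr_small R (7 / 8) r; rewrite //; try lra.
apply: le_trans (bound n c sc pc cp) _; rewrite mulrAC.
by rewrite ler_wpM2l ?mulr_ge0 ?nr_ge0// ltW.
Qed.

Lemma corner_central c : p ** c = c -> c ** p = c -> d ** c = c ** d.
Proof.
case: p_proj => sp pp pc cp; have [u [v [su sv cE]]] := decomp_sa c.
have conj_sa a : selfadjoint a -> d ** (p ** a ** p) = p ** a ** p ** d.
  move=> sa; apply: corner_commutator.
  - by rewrite -{1}sp; exact: sa_conj.
  - by rewrite !cmulA pp.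
  - by rewrite -!cmulA pp.
have -> : c = p ** u ** p + 'i *: (p ** v ** p).
  by rewrite -{1}cp -{1}pc cE; ncexpand.
by rewrite cmulDl cmulDr cmulZl cmulZr !conj_sa.
Qed.

End CornerCommutation.

(** * The uniform boundedness principle *)

Section UniformBoundedness.
Variables (R : realType) (V : completeNormedModType R[i]).
Variable W : normedModType R[i].
Variables (I : Type) (f : I -> V -> W).
Hypothesis f_lin : forall i, linear (f i).
Hypothesis f_bnd : forall i, exists C : R, forall x, nr (f i x) <= C * nr x.
Hypothesis f_pt : forall x, exists C : R, forall i, nr (f i x) <= C.

Let fD i x y : f i (x + y) = f i x + f i y.
Proof. by have := f_lin i 1 x y; rewrite !scale1r. Qed.
Let f0 i : f i 0 = 0.
Proof. by apply: (addrI (f i 0)); rewrite -fD !addr0. Qed.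
Let fZ i k x : f i (k *: x) = k *: f i x.
Proof. by have := f_lin i k x 0; rewrite f0 !addr0. Qed.
Let fN i x : f i (- x) = - f i x.
Proof. by rewrite -scaleN1r fZ scaleN1r. Qed.

(* One of f (x + y), f (x - y) is at least as large as f y, so unboundedness
   can be moved to any small ball: nested balls replace Baire's theorem. *)
Theorem uniform_boundedness :
  exists2 C : R, 0 <= C & forall i x, nr (f i x) <= C * nr x.
Proof.
apply: contrapT => H.
have unbnd (C : R) : 0 <= C -> exists i x, C * nr x < nr (f i x).
  move=> C0; apply: contrapT => h; apply: H; exists C => // i x.
  by rewrite leNgt; apply/negP => hx; apply: h; exists i, x.
have step (s : nat * (V * R)) : exists s' : V * R, 0 < s.2.2 ->
    [/\ 0 < s'.2, nr (s'.1 - s.2.1) <= s.2.2 / 2, s'.2 <= s.2.2 / 2 &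
    exists i, forall w, nr (w - s'.1) <= s'.2 -> s.1%:R <= nr (f i w)].
  case: s => n [x r] /=.
  have [r0|r0] := ltrP 0 r; last by exists (x, r) => /=; rewrite ltNge r0.
  have n1 : 0 <= n.+1%:R / (r / 2) by rewrite divr_ge0// divr_ge0// ltW.
  have [i [y hy]] := unbnd _ n1.
  have y0 : 0 < nr y.
    rewrite lt_neqAle nr_ge0 andbT eq_sym; apply/eqP => /nr0_eq0 y0.
    by move: hy; rewrite y0 f0 !nr0 mulr0 ltxx.
  pose y' := (r / 2 / nr y)%:C *: y.
  have ny' : nr y' = r / 2.
    rewrite nrZr ger0_norm ?divfK ?lt0r_neq0//.
    by rewrite !divr_ge0// ltW.
  have fy' : n.+1%:R < nr (f i y').
    rewrite fZ nrZr ger0_norm; last by rewrite !divr_ge0// ltW.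
    rewrite mulrAC ltr_pdivlMr//.
    have r20 : 0 < r / 2 by rewrite divr_gt0.
    by move: hy; rewrite mulrAC ltr_pdivrMr// (mulrC (nr (f i y))).
  have [x' [x'x fx']] : exists x', nr (x' - x) = r / 2 /\ n.+1%:R < nr (f i x').
    have : 2 * nr (f i y') <= nr (f i (x + y')) + nr (f i (x - y')).
      rewrite !fD fN.
      apply: le_trans (nrB _ _).
      have -> : f i x + f i y' - (f i x - f i y') = 2%:C *: f i y' by lmod.
      by rewrite nrZr ger0_norm.
    have [h|h] := ltrP n.+1%:R (nr (f i (x + y'))).
      by exists (x + y'); rewrite addrAC subrr add0r.
    exists (x - y'); rewrite addrAC subrr add0r nrN; split => //; lra.
  have [C hC] := f_bnd i.
  have C1 : 0 < `|C| + 1 by apply: ltr_wpDl.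
  (* On a ball of this radius f i varies by at most 1, so a value above n + 1 at the centre stays
     above n. *)
  exists (x', Num.min (r / 2) (`|C| + 1)^-1) => _ /=; split.
  - by rewrite lt_min divr_gt0//= invr_gt0.
  - by rewrite x'x.
  - by rewrite ge_min lexx.
  - exists i => w; rewrite le_min => /andP[_].
    rewrite -div1r ler_pdivlMr// => hw.
    have h1 := hC (w - x'); rewrite fD fN in h1.
    have h2 := nr_le_dist (f i x') (f i w); rewrite nr_dist in h2.
    have h3 : C * nr (w - x') <= nr (w - x') * (`|C| + 1).
      by rewrite mulrC ler_wpM2l ?nr_ge0//; have := ler_norm C; lra.
    have nS : n.+1%:R = n%:R + 1 :> R by rewrite -natr1.
    by rewrite nS in fx'; lra.
have [g hg] := choice step.
pose s := fix s n := if n is n'.+1 then g (n', s n') else (0 : V, 1 : R).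
have s0 n : 0 < (s n).2.
  by elim: n => [|n IHn] //=; case: (hg (n, s n) IHn).
have sP n := hg (n, s n) (s0 n).
(* Negated radii majorize the centres: a step moves at most half the radius, and the radius drops by
   at least half. The error bound against the upper bound 0 then places the limit in every ball. *)
pose x n := (s n).1; pose z n := - (s n).2.
have xz n : nr (x n.+1 - x n) <= z n.+1 - z n.
  by rewrite /x /z; case: (sP n) => /= _ h1 h2 _; lra.
have z0 n : z n <= 0 by rewrite oppr_le0 ltW.
have [l _ xl] := dominated_tends xz z0.
have lx n : nr (l - x n) <= (s n).2.
  by apply: le_trans (xl n) _; rewrite sub0r opprK.
have [C hC] := f_pt l.
have [i hi] : exists i, (Num.truncn C).+1%:R <= nr (f i l).
  case: (sP (Num.truncn C).+1) => _ _ _ [i hi]; exists i.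
  by apply: hi; exact: lx _.+1.
have := le_trans hi (hC i); have := truncnS_gt C; lra.
Qed.

End UniformBoundedness.

Lemma tends_innerr (R : realType) (A : cstarAlgType R)
    (G : hilbertModType A) (x : G) (u : nat -> G) l :
  tends u l -> tends (fun n => inner x (u n) : A) (inner x l).
Proof.
move=> ul; apply: (tends_squeeze (C := nr x) ul) => n.
by rewrite -innerBr cauchy_schwarz.
Qed.

Lemma tends_innerl (R : realType) (A : cstarAlgType R)
    (G : hilbertModType A) (x : G) (u : nat -> G) l :
  tends u l -> tends (fun n => inner (u n) x : A) (inner l x).
Proof.
move=> ul; apply: (tends_squeeze (C := nr x) ul) => n.
by rewrite -innerBl mulrC cauchy_schwarz.
Qed.

Lemma tends_of_dense (R : realType) (V : normedModType R[i])
    (S : V -> Prop) (x : V) :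
  (forall r : R, 0 < r -> exists y, S y /\ nr (x - y) < r) ->
  exists u : nat -> V, (forall n, S (u n)) /\ tends u x.
Proof.
move=> h.
have /choice [u hu] : forall n : nat, exists y, S y /\ nr (x - y) < 2^-1 ^+ n.
  by move=> n; apply: h; rewrite exprn_gt0.
exists u; split => [n|r r0]; first by case: (hu n).
have [|||N hN] := @expr_small R 2^-1 r; rewrite //; try lra.
exists N => n Nn; rewrite nr_dist; case: (hu n) => _ h1.
apply: lt_trans h1 _; apply: le_lt_trans hN.
by apply: ler_wiXn2l => //; rewrite ?invr_ge0// invf_le1// ler1n.
Qed.

(** * Orthogonality preserving maps: local identities and boundedness *)

Section OrthogonalityPreserving.
Variables (R : realType) (A : cstarAlgType R) (E F : hilbertModType A).
Variable theta : {linear E -> F}.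
Hypothesis A0 : real_rank_zero A.
Hypothesis theta_mod : module_map theta.
Hypothesis theta_orth : orthogonality_preserving theta.
Implicit Types (a b c p q : A) (x y z w : E).

Local Notation phi x y := (inner (theta x) (theta y) : A).

Let phi_ractl x y a : phi (ract x a) y = star a ** phi x y.
Proof. by rewrite theta_mod inner_ractl. Qed.

Let phi_ractr x y a : phi x (ract y a) = phi x y ** a.
Proof. by rewrite theta_mod inner_ract. Qed.

(** Such a [z] acts as a partial isometry: y -> z <z, y> is the orthogonal projection of E onto z
    A. *)
Definition proj_norm p z := projection p /\ inner z z = p.

Lemma ract_proj_norm p z : proj_norm p z -> ract z p = z.
Proof.
move=> [[sp pp] zp]; apply/esym/eqP; rewrite -subr_eq0; apply/eqP.
apply: nr0_eq0; apply/eqP; rewrite -sqrf_eq0 nr_sub_ract zp sp !pp.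
by rewrite subrr sub0r addNr nr0.
Qed.

Lemma proj_norm_inner p z y : proj_norm p z -> p ** inner z y = inner z y.
Proof.
move=> zp; have := ract_proj_norm zp; case: zp => [[sp _] _] zpz.
by rewrite -{2}zpz inner_ractl sp.
Qed.

Lemma phi_proj_normr p z y : proj_norm p z -> phi z y = phi z z ** inner z y.
Proof.
move=> zp; have := theta_orth (x := z) (y := y - ract z (inner z y)).
rewrite innerBr inner_ract; case: (zp) => _ ->.
rewrite (proj_norm_inner _ zp) subrr => /(_ erefl).
by rewrite linearB innerBr phi_ractr => /eqP; rewrite subr_eq0 => /eqP.
Qed.

Lemma phi_proj_norml p z y : proj_norm p z -> phi y z = inner y z ** phi z z.
Proof.
move=> zp; rewrite -[LHS]star_inner (phi_proj_normr y zp) starM.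
by rewrite !star_inner.
Qed.

(** The zero product condition of [corner_central] comes from the vectors z a^* and z b, whose inner
    product is a p b. *)
Lemma phi_proj_norm_central p z c : proj_norm p z ->
  p ** c = c -> c ** p = c -> phi z z ** c = c ** phi z z.
Proof.
move=> zp; have zpz := ract_proj_norm zp; case: (zp) => -[sp pp] zzp.
apply: (corner_central A0) => //.
- by rewrite -{3}zpz phi_ractl sp.
- by rewrite -{4}zpz phi_ractr.
- move=> a b ab0.
  have := theta_orth (x := ract z (star a)) (y := ract z b).
  by rewrite inner_ract2 starK zzp phi_ractl phi_ractr starK cmulA => /(_ ab0).
Qed.

(* With y = w - z <z, w>, which is orthogonal to z, and k = <y, y>, the vectors
   z - y b^* and z b k + y are orthogonal. *)
Lemma phi_proj_norm_inter p q z w b : proj_norm p z -> proj_norm q w ->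
  p ** b = b -> b ** q = b -> phi z z ** b = b ** phi w w.
Proof.
move=> zp wq pb bq.
have [dp dpE] : exists dp, dp = phi z z by eexists.
have [dq dqE] : exists dq, dq = phi w w by eexists.
have [g gE] : exists g, g = inner z w :> A by eexists.
have [y yE] : exists y, y = w - ract z g by eexists.
have [k kE] : exists k, k = q - star g ** g by eexists.
have pg : p ** g = g by rewrite gE (proj_norm_inner _ zp).
have sg : inner w z = star g :> A by rewrite gE star_inner.
have gq : g ** q = g.
  by rewrite gE -inner_ract (ract_proj_norm wq).
have [[sp pp] zzp] := zp; have [[sq qq] wwq] := wq.
have zy : inner z y = 0 :> A by rewrite yE innerBr inner_ract zzp -gE pg subrr.
have wy : inner w y = k by rewrite yE innerBr inner_ract wwq sg kE.
have yz : inner y z = 0 :> A by rewrite -star_inner zy star0.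
have yy : inner y y = k by rewrite {1}yE innerBl inner_ractl zy wy cmul0r subr0.
have pzy : phi z y = 0 by apply: theta_orth.
have pyz : phi y z = 0 by apply: theta_orth.
have pyy : phi y y = dq ** k.
  rewrite {1}yE linearB innerBl phi_ractl pzy cmul0r subr0.
  by rewrite (phi_proj_normr y wq) wy dqE.
have h1 : dp ** b ** k = b ** dq ** k.
  have := theta_orth (x := z - ract y (star b)) (y := ract z (b ** k) + y).
  rewrite innerBl !innerDr !inner_ract !inner_ractl zzp zy yz yy starK.
  rewrite cmul0r addr0 !cmul0l add0r cmulA pb subrr => /(_ erefl).
  rewrite linearB linearD innerBl !innerDr !phi_ractr !phi_ractl pzy pyz pyy
    starK.
  rewrite cmul0r addr0 !cmul0l add0r -dpE => /eqP; rewrite subr_eq0 => /eqP.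
  by rewrite !cmulA.
(* The remaining part of b = b k + b g^* g. Here b g^* lies in p A p, hence commutes with dp, and dp
   g = phi z w = g dq. *)
have h2 : dp ** b ** star g ** g = b ** dq ** star g ** g.
  have c1 : dp ** (b ** star g) = b ** star g ** dp.
    rewrite dpE; apply: (phi_proj_norm_central zp).
      by rewrite cmulA pb.
    by rewrite -cmulA -{1}sp -starM pg.
  have c2 : dq ** (star g ** g) = star g ** g ** dq.
    rewrite dqE; apply: (phi_proj_norm_central wq).
      by rewrite cmulA -{1}sq -starM gq.
    by rewrite -cmulA gq.
  have c3 : dp ** g = g ** dq.
    by rewrite dpE dqE gE -(phi_proj_normr _ zp) -(phi_proj_norml _ wq).
  by rewrite -(cmulA dp b) c1 -!cmulA c3 c2 !cmulA.
rewrite -dpE -dqE.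
have -> : dp ** b = dp ** b ** k + dp ** b ** star g ** g.
  by rewrite -(cmulA _ (star g)) -cmulDr kE subrK -cmulA bq.
have dqq : dq ** q = dq by rewrite dqE -phi_ractr (ract_proj_norm wq).
by rewrite h1 h2 -(cmulA _ (star g)) -cmulDr kE subrK -cmulA dqq.
Qed.

Definition cuttable x := exists p z a, proj_norm p z /\ x = ract z a.

(** With x = x' a and w = w' b factored out, phi x' x' has to be moved across <x', y> <z, w'>, an
    element of p A q, where it becomes phi w' w'. No condition falls on [y] and [z]. *)
Lemma cuttable_inter x y z w : cuttable x -> cuttable w ->
  phi x y ** inner z w = inner x y ** phi z w.
Proof.
move=> [p [x' [a [xp ->]]]] [q [w' [b [wq ->]]]].
rewrite phi_ractl phi_ractr inner_ract inner_ractl.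
rewrite (phi_proj_normr y xp) (phi_proj_norml z wq) !cmulA.
congr (_ ** _); rewrite -!cmulA; congr (_ ** _); rewrite (cmulA (inner x' y)).
apply: (phi_proj_norm_inter xp wq).
  by rewrite cmulA (proj_norm_inner _ xp).
by rewrite -cmulA -(inner_ract z) (ract_proj_norm wq).
Qed.

Lemma cuttable_dense x (r : R) : 0 < r ->
  exists p, [/\ selfadjoint p, cuttable (ract x p) & nr (x - ract x p) < r].
Proof.
(* The squared error 2 d is then at most r^2 / 2. *)
move=> r0; pose d := Num.min (r ^+ 2 / 4) 1.
have r2 : 0 < r ^+ 2 by rewrite exprn_gt0.
have d0 : 0 < d by rewrite lt_min ltr01 divr_gt0.
have d1 : d <= 1 by rewrite ge_min lexx orbT.
have dr : d <= r ^+ 2 / 4 by rewrite ge_min lexx.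
have [p [s [t [sp pp st xs xp]]]] := spectral_cut A0 x d0 d1.
exists p; split => //.
  exists p, (ract x s), t; split; first by split.
  by rewrite -ractM st.
rewrite -(@ltr_pXn2r _ 2)// ?nnegrE ?nr_ge0 ?(ltW r0)//.
by apply: le_lt_trans xp _; lra.
Qed.

(** Differences of cuttable vectors are not shown to be cuttable; this larger set is closed under
    them, as the Cauchy argument for [theta] requires. *)
Let bounded_at w := exists C : R, forall y, nr (phi w y) <= C * nr y.

Let cuttable_bounded_at w : cuttable w -> bounded_at w.
Proof.
move=> [p [z [a [zp ->]]]]; exists (nr a * nr (phi z z) * nr z) => y.
rewrite phi_ractl (phi_proj_normr y zp) cmulA -mulrA.
apply: nrM_le; last exact: cauchy_schwarz.
by apply: nrM_le => //; rewrite nr_star.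
Qed.

Let bounded_atB w w' : bounded_at w -> bounded_at w' -> bounded_at (w - w').
Proof.
move=> [C hC] [C' hC']; exists (C + C') => y.
rewrite linearB innerBl mulrDl; apply: le_trans (nrB _ _) _.
exact: lerD.
Qed.

Let bounded_atZ (r : R) w : bounded_at w -> bounded_at (r%:C *: w).
Proof.
move=> [C hC]; exists (`|r| * C) => y.
by rewrite linearZ innerZl conjc_real nrZr -mulrA ler_wpM2l.
Qed.

(** The family is phi w with ||theta w|| <= 1, and Cauchy-Schwarz gives the pointwise bounds. For
    general w, normalize by t = ||theta w|| and evaluate at w itself: phi (w / t) w has norm t. *)
Lemma bounded_at_uniform : exists2 K : R, 0 <= K &
  forall w, bounded_at w -> nr (theta w) <= K * nr w.
Proof.
pose I := {w : E | bounded_at w /\ nr (theta w) <= 1}.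
pose f (i : I) (y : E) : A := phi (sval i) y.
have [||| K K0 fK] := @uniform_boundedness R E A I f.
- by move=> i k x y; rewrite /f linearD linearZ innerDr innerZr.
- by case=> w [].
- move=> y; exists (nr (theta y)) => -[w [wb w1]]; rewrite /f /=.
  by apply: le_trans (cauchy_schwarz _ _) _; rewrite ler_piMl ?nr_ge0.
exists K => // w wb.
have [->|w0] := eqVneq (nr (theta w)) 0; first by rewrite mulr_ge0 ?nr_ge0.
have t0 : 0 < nr (theta w) by rewrite lt_neqAle eq_sym w0 nr_ge0.
set t := nr (theta w) in t0 *.
have ti : `|t^-1| = t^-1 by rewrite ger0_norm// invr_ge0 ltW.
have w1 : nr (theta ((t^-1)%:C *: w)) <= 1.
  by rewrite linearZ nrZr ti mulVf ?lt0r_neq0.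
have := fK (exist _ _ (conj (bounded_atZ t^-1 wb) w1)) w.
rewrite /f /= linearZ innerZl conjc_real nrZr ti -nr_inner -/t expr2 mulrA.
by rewrite mulVf ?lt0r_neq0// mul1r.
Qed.

(** Without continuity of [theta], density cannot be applied to x -> <y, theta x>. Instead let g =
    <y, theta x>: g p = 0 for every p cutting x, so g <x, x> = g <x - x p, x> is arbitrarily small,
    hence 0. Then theta x g^* = theta (x g^* ) = 0, and g g^* = 0. *)
Lemma cuttable_perp (y : F) :
  (forall z, cuttable z -> inner y (theta z) = 0 :> A) ->
  forall x, inner y (theta x) = 0 :> A.
Proof.
move=> yz x.
have [g gE] : exists g, g = inner y (theta x) :> A by eexists.
have [h hE] : exists h, h = inner x x :> A by eexists.
have gh : g ** h = 0.
  apply: (@nr_small_eq0 _ _ (nr g * nr x)) => r r0.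
  have [p [sp xp xpr]] := cuttable_dense x r0.
  have gp : g ** p = 0 by rewrite gE -inner_ract -theta_mod yz.
  have -> : g ** h = g ** inner (x - ract x p) x.
    by rewrite innerBl inner_ractl sp cmulDr cmulNr cmulA gp cmul0l subr0 hE.
  rewrite -mulrA (mulrC (nr x)); apply: nrM_le => //.
  apply: le_trans (cauchy_schwarz _ _) _.
  by rewrite ler_wpM2r ?nr_ge0// ltW.
have tx0 : ract (theta x) (star g) = 0.
  rewrite -theta_mod; apply: (@inner_eq0 _ A); apply: theta_orth.
  by rewrite inner_ract2 starK -hE gh cmul0l.
have : g ** star g = 0 by rewrite {1}gE -inner_ract tx0 inner0r.
rewrite -gE -{1}(starK g) => /starM_eq0 => sg0.
by rewrite -(starK g) sg0 star0.
Qed.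

Lemma cuttable_tends x : exists u : nat -> E,
  (forall n, cuttable (u n)) /\ tends u x.
Proof.
apply: tends_of_dense => r /(cuttable_dense x) [p [_ xp h]].
by exists (ract x p).
Qed.

(** Let l be the limit of theta (u n) for cuttable u n tending to x. Since phi z is bounded for
    cuttable z, theta x - l is orthogonal to theta z, hence to the whole range of [theta]. It lies
    in the closure of that range, so it is 0. *)
Lemma theta_bounded : exists2 K : R, 0 <= K &
  forall x, nr (theta x) <= K * nr x.
Proof.
have [K K0 hK] := bounded_at_uniform; exists K => // x.
have [u [uc ux]] := cuttable_tends x.
have ub n := cuttable_bounded_at (uc n).
have [l ul] : exists l, tends (fun n => theta (u n)) l.
  apply: nr_complete => r r0.
  have K1 : 0 < K + 1 by lra.
  have [|N hN] := tends_cauchy ux (e := r / (K + 1)); first by rewrite divr_gt0.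
  exists N => n m Nn Nm; rewrite -linearB.
  apply: le_lt_trans (hK _ (bounded_atB (ub n) (ub m))) _.
  have := hN n m Nn Nm; rewrite ltr_pdivlMr// => h.
  by have := nr_ge0 (u n - u m); lra.
have y0 : inner (theta x - l) (theta x - l) = 0 :> A.
  have perp : forall z, inner (theta x - l) (theta z) = 0 :> A.
    apply: cuttable_perp => z zc; rewrite -star_inner innerBr.
    have [C hC] := cuttable_bounded_at zc.
    suff -> : phi z x = inner (theta z) l by rewrite subrr star0.
    apply: tends_unique (tends_innerr (theta z) ul).
    apply: (tends_squeeze (C := C) ux) => n.
    by rewrite -innerBr -linearB.
  rewrite innerBr perp sub0r; apply/eqP; rewrite oppr_eq0; apply/eqP.
  apply: (tends_unique (tends_innerr _ ul)).
  by apply: tends_ext (tends_cst 0) => n; rewrite perp.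
have /eqP := inner_eq0 y0; rewrite subr_eq0 => /eqP ->.
apply/ler_addgt0Pr => r r0.
have [|N hN] := ul (r / 2); first by rewrite divr_gt0.
have K1 : 0 < K + 1 by lra.
have [|M hM] := ux (r / 2 / (K + 1)); first by rewrite !divr_gt0.
have := hN _ (leq_maxl N M); have := hM _ (leq_maxr N M).
set n := maxn N M; rewrite ltr_pdivlMr// => h1 h2.
have h3 := nr_le_dist l (theta (u n)); rewrite nr_dist in h3.
have h4 := hK _ (ub n).
have h5 : K * nr (u n) <= K * (nr x + nr (u n - x)).
  by rewrite ler_wpM2l// nr_le_dist.
have := nr_ge0 (u n - x); lra.
Qed.

Lemma phi_inter x y z w : phi x y ** inner z w = inner x y ** phi z w.
Proof.
have [K K0 hK] := theta_bounded.
have tT u l : tends u l -> tends (fun n => theta (u n)) (theta l).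
  by move=> ul; apply: (tends_squeeze (C := K) ul) => n; rewrite -linearB.
have [u [uc ux]] := cuttable_tends x; have [v [vc vw]] := cuttable_tends w.
have inter_w n : phi x y ** inner z (v n) = inner x y ** phi z (v n).
  apply: tends_unique (tendsMr _ (tends_innerl _ ux)).
  apply: tends_ext (tendsMr _ (tends_innerl _ (tT _ _ ux))) => m.
  exact: cuttable_inter.
apply: tends_unique (tendsMl _ (tends_innerr _ (tT _ _ vw))).
by apply: tends_ext (tendsMl _ (tends_innerr _ vw)) => m; rewrite inter_w.
Qed.

End OrthogonalityPreserving.

(** * Recovering norms in A from a full module *)

Section FullModules.
Variables (R : realType) (A : cstarAlgType R) (E : hilbertModType A).
Hypothesis E_full : full E.
Implicit Types (a b c s : A) (x y z : E).

Definition inner_span a := exists n (k : 'I_n -> R[i]) (x y : 'I_n -> E),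
  a = \sum_(i < n) k i *: inner (x i) (y i).

Lemma full_approx a (r : R) : 0 < r -> exists b, inner_span b /\ nr (a - b) < r.
Proof.
move=> r0; have r0' : 0 < r%:C :> R[i] by rewrite ltcR.
have [|b [ab sb]] := E_full (O := ball a r%:C) _ (ball_open a _).
  by exists a; apply: ballxx.
exists b; split => //.
by move: ab; rewrite -ball_normE /ball_ /= nrE ltcR.
Qed.

Lemma inner_span_mulr_eq0 a b : inner_span b ->
  (forall x y, a ** inner x y = 0) -> a ** b = 0.
Proof.
move=> [n [k [x [y ->]]]] h; elim/big_rec: _ => [|i b' _ IH];
  first exact: cmul0r.
by rewrite cmulDr IH cmulZr h scaler0 addr0.
Qed.

Lemma full_mulr_eq0 a : (forall x y, a ** inner x y = 0) -> a = 0.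
Proof.
move=> h; rewrite -(starK a) (starM_eq0 (a := star a)) ?star0// starK.
apply: (@nr_small_eq0 _ _ (nr a)) => r r0.
have [b [sb br]] := full_approx (star a) r0.
have -> : a ** star a = a ** (star a - b).
  by rewrite cmulDr cmulNr (inner_span_mulr_eq0 sb h) subr0.
by apply: nrM_le => //; exact: ltW.
Qed.

(** <x, y> c = <x, y c>, so the action of [c] on E controls b c. The constant depends on [b] alone,
    uniformly in [c]. *)
Lemma inner_span_mulr_bound b : inner_span b -> exists2 C : R, 0 <= C &
  forall c (D : R), 0 <= D -> (forall x, nr (ract x c) <= D * nr x) ->
    nr (b ** c) <= C * D.
Proof.
move=> [n [k [x [y ->]]]].
pose C i := complex.Re `|k i| * (nr (x i) * nr (y i)).
have C0 i : 0 <= C i.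
  by rewrite !mulr_ge0 ?nr_ge0//; exact: (nr_ge0 (k i : R[i]^o)).
exists (\sum_i C i); first exact: sumr_ge0.
move=> c D D0 h; elim/big_rec2: _ => [|i t b' _ IH].
  by rewrite cmul0l nr0 mul0r.
rewrite cmulDl mulrDl; apply: le_trans (nrD _ _) _; apply: lerD => //.
rewrite cmulZl nrZ -inner_ract -mulrA ler_wpM2l ?(nr_ge0 (k i : R[i]^o))//.
apply: le_trans (cauchy_schwarz _ _) _.
by rewrite -mulrA ler_wpM2l ?nr_ge0// mulrC.
Qed.

(* Powers s^(n+1), with n = 2^k - 1 so that their norms are known. *)
Let powers s (D : R) : selfadjoint s -> 0 <= D ->
  (forall x, nr (ract x s) <= D * nr x) -> forall k, exists n r,
  [/\ (k <= n)%N, selfadjoint r, ccomm s r & [/\ nr (s ** r) = nr s ^+ n.+1,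
      nr r <= nr s ^+ n & forall x, nr (ract x r) <= D ^+ n * nr x]].
Proof.
move=> ss D0 sD; elim=> [|k [n [r [kn sr cr [nsr nr_r rD]]]]].
  exists 1%N, s; split=> //; split => //; rewrite ?expr1//.
  by rewrite nr_sa_sqr.
exists (n + n).+1, (r ** s ** r); split.
- by rewrite ltnS (leq_trans kn)// leq_addr.
- by rewrite /selfadjoint !starM sr ss cmulA.
- by rewrite /ccomm !cmulA cr -(cmulA (r ** s)) cr cmulA.
- split.
  + have -> : s ** (r ** s ** r) = s ** r ** (s ** r) by rewrite !cmulA.
    rewrite nr_sa_sqr; last exact: saM.
    by rewrite nsr -exprM; congr (_ ^+ _); rewrite muln2 -addnn addSn addnS.
  + apply: le_trans (nrM2 _ _ _) _; rewrite exprS exprD.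
    have -> : nr r * nr s * nr r = nr s * (nr r * nr r) by ring.
    by rewrite ler_wpM2l ?nr_ge0// ler_pM ?nr_ge0.
  + move=> x; rewrite !ractM; apply: le_trans (rD _) _.
    have -> : D ^+ (n + n).+1 * nr x = D ^+ n * (D * (D ^+ n * nr x)).
      by rewrite exprS exprD; ring.
    rewrite ler_wpM2l ?exprn_ge0//; apply: le_trans (sD _) _.
    by rewrite ler_wpM2l.
Qed.

(** Suppose D < t = ||s|| and take b in the span within t / 2 of s. Applied to s^n this gives
    t^(n+1) <= (t / 2) t^n + C D^n. Nothing is known of C, but (D / t)^n tends to 0, so high powers
    give a contradiction. *)
Lemma sa_ract_norm s (D : R) : selfadjoint s -> 0 <= D ->
  (forall x, nr (ract x s) <= D * nr x) -> nr s <= D.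
Proof.
move=> ss D0 sD; rewrite leNgt; apply/negP => Ds.
set t := nr s in Ds *; have t0 : 0 < t by exact: le_lt_trans Ds.
have t20 : 0 < t / 2 by rewrite divr_gt0.
have [b [sb br]] := full_approx s t20.
have [C C0 hC] := inner_span_mulr_bound sb.
have C1 : 0 < C + 1 by lra.
have Dt0 : 0 <= D / t by rewrite divr_ge0// ltW.
have Dt1 : D / t < 1 by rewrite ltr_pdivrMr// mul1r.
have [|k hk] := @expr_small R (D / t) (t / 2 / (C + 1)) Dt0 Dt1.
  by rewrite divr_gt0.
have [n [r [kn sr cr [nsr nr_r rD]]]] := powers ss D0 sD k.
have tn0 : 0 < t ^+ n by rewrite exprn_gt0.
have h1 : t ^+ n.+1 <= t / 2 * t ^+ n + C * D ^+ n.
  rewrite -nsr -{1}(subrK b s) cmulDl; apply: le_trans (nrD _ _) _.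
  apply: lerD; first by apply: nrM_le => //; exact: ltW.
  by apply: hC => //; exact: exprn_ge0.
have h2 : t / 2 <= C * (D / t) ^+ n.
  rewrite expr_div_n mulrA ler_pdivlMr//.
  by move: h1; rewrite exprS; move: (t ^+ n) (D ^+ n) => x y; lra.
have h3 : (D / t) ^+ n <= (D / t) ^+ k by apply: ler_wiXn2l => //; exact: ltW.
move: hk; rewrite ltr_pdivlMr// => h4.
have h5 : C * (D / t) ^+ n <= C * (D / t) ^+ k by rewrite ler_wpM2l.
have h6 : 0 <= (D / t) ^+ k by exact: exprn_ge0.
move: h2 h4 h5 h6; move: ((D / t) ^+ n) ((D / t) ^+ k) => x y; lra.
Qed.

(** Choosing y = x c bounds the right action of c by C, and likewise that of c^*. So the
    self-adjoint c c^* acts with norm at most C^2, where [sa_ract_norm] applies. *)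
Lemma inner_mul_norm c (C : R) : 0 <= C ->
  (forall x y, nr (inner y x ** c) <= C * (nr y * nr x)) ->
  (forall x y, nr (inner y x ** star c) <= C * (nr y * nr x)) -> nr c <= C.
Proof.
move=> C0 h1 h2.
have ract_le b : (forall x y, nr (inner y x ** b) <= C * (nr y * nr x)) ->
    forall x, nr (ract x b) <= C * nr x.
  move=> h x; have [->|y0] := eqVneq (nr (ract x b)) 0.
    by rewrite mulr_ge0 ?nr_ge0.
  rewrite -(ler_pM2l (x := nr (ract x b))); last first.
    by rewrite lt_neqAle eq_sym y0 nr_ge0.
  rewrite -expr2 nr_inner inner_ract mulrCA; exact: h.
rewrite -(@ler_pXn2r _ 2)// ?nnegrE ?nr_ge0// -(nr_star c) -nr_starM starK.
apply: sa_ract_norm; first by rewrite /selfadjoint starM starK.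
  exact: sqr_ge0.
move=> x; rewrite ractM expr2 -mulrA; apply: le_trans (ract_le _ h2 _) _.
by rewrite ler_wpM2l// ract_le.
Qed.

End FullModules.

(** * Construction of the central positive multiplier *)

Section Multiplier.
Variables (R : realType) (A : cstarAlgType R) (E F : hilbertModType A).
Variable theta : {linear E -> F}.
Hypothesis A0 : real_rank_zero A.
Hypothesis E_full : full E.
Hypothesis theta_mod : module_map theta.
Hypothesis theta_orth : orthogonality_preserving theta.
Implicit Types (a b c g : A) (x y z w : E).

Local Notation phi x y := (inner (theta x) (theta y) : A).

Let phi_ractl x y a : phi (ract x a) y = star a ** phi x y.
Proof. by rewrite theta_mod inner_ractl. Qed.

Let phi_ractr x y a : phi x (ract y a) = phi x y ** a.
Proof. by rewrite theta_mod inner_ract. Qed.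

(* [image a g] says that g = u a for the multiplier u to be constructed. *)
Let image a g := forall x y, g ** inner x y = a ** phi x y.

Let image_unique a g g' : image a g -> image a g' -> g = g'.
Proof.
move=> h h'; apply/eqP; rewrite -subr_eq0; apply/eqP.
apply: (full_mulr_eq0 E_full) => x y.
by rewrite cmulDl cmulNl h h' subrr.
Qed.

Let image_lin (k : R[i]) a g a' g' :
  image a g -> image a' g' -> image (k *: a + a') (k *: g + g').
Proof. by move=> h h' x y; rewrite !cmulDl !cmulZl h h'. Qed.

Let image_sub a g a' g' : image a g -> image a' g' -> image (a - a') (g - g').
Proof. by move=> h h' x y; rewrite !cmulDl !cmulNl h h'. Qed.

Let imageMr a g c : image a g -> image (a ** c) (g ** c).
Proof.
move=> h x y; rewrite -!cmulA.
have := h (ract x (star c)) y; rewrite inner_ractl phi_ractl starK; exact.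
Qed.

Let imageMl a g c : image a g -> image (c ** a) (c ** g).
Proof. by move=> h x y; rewrite -!cmulA h. Qed.

Let image_inner z w : image (inner z w) (phi z w).
Proof. by move=> x y; apply: (phi_inter A0). Qed.

(** Both sides are images of <z, w> a. This left-handed form is the source of compatibility with the
    adjoint and of the norm estimates. *)
Let image_left a g : image a g -> forall z w, inner z w ** g = phi z w ** a.
Proof.
move=> h z w; apply: (image_unique (imageMl (inner z w) h)).
exact: imageMr (image_inner z w).
Qed.

Let image_star a g : image a g -> image (star a) (star g).
Proof.
move=> /image_left h x y.
by rewrite -(star_inner y x) -starM h starM star_inner.
Qed.

Let image_norm (K : R) a g : 0 <= K -> (forall x, nr (theta x) <= K * nr x) ->
  image a g -> nr g <= K ^+ 2 * nr a.
Proof.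
move=> K0 hK h.
have bnd b c : image b c -> forall x y,
    nr (inner y x ** c) <= K ^+ 2 * nr b * (nr y * nr x).
  move=> /image_left hbc x y; rewrite hbc mulrAC.
  apply: nrM_le => //; apply: le_trans (cauchy_schwarz _ _) _.
  have -> : K ^+ 2 * (nr y * nr x) = (K * nr y) * (K * nr x) by ring.
  by rewrite ler_pM ?nr_ge0.
apply: (inner_mul_norm E_full); first by rewrite mulr_ge0 ?sqr_ge0 ?nr_ge0.
- exact: bnd.
- by have := bnd _ _ (image_star h); rewrite nr_star.
Qed.

Let image_span b : inner_span E b -> exists g, image b g.
Proof.
move=> [n [k [x [y ->]]]]; exists (\sum_(i < n) k i *: phi (x i) (y i)).
elim/big_rec2: _ => [|i g b' _ IH]; last exact: image_lin.
by move=> z w; rewrite !cmul0l.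
Qed.

Let image_exists a : exists g, image a g.
Proof.
have [K K0 hK] := theta_bounded A0 theta_mod theta_orth.
have [u [us ua]] := tends_of_dense (@full_approx _ _ _ E_full a).
have /choice [v uv] : forall n, exists g, image (u n) g.
  by move=> n; exact: image_span.
have [g vg] : exists g, tends v g.
  apply: nr_complete => r r0.
  have K1 : 0 < K ^+ 2 + 1 by rewrite ltr_wpDl// sqr_ge0.
  have [|N hN] := tends_cauchy ua (e := r / (K ^+ 2 + 1));
    first by rewrite divr_gt0.
  exists N => n m Nn Nm.
  apply: le_lt_trans (image_norm K0 hK (image_sub (uv n) (uv m))) _.
  have := hN n m Nn Nm; rewrite ltr_pdivlMr//.
  by have := nr_ge0 (u n - u m); lra.
exists g => x y; apply: (tends_unique (tendsMr _ vg)).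
by apply: tends_ext (tendsMr _ ua) => n; rewrite uv.
Qed.

(** psi plays the part of the form of M - theta^* theta, although [theta] is not known to be
    adjointable. On y = z b it becomes b^* p (M - d) p <z, x> with 0 <= d <= M, where [pos_near]
    bounds the middle factor; density extends the bound to all y. *)
Let image_pos (K : R) a g : 0 <= K -> (forall x, nr (theta x) <= K * nr x) ->
  image a g -> nr ((K ^+ 2 + 1)%:C *: a - g) <= (K ^+ 2 + 1) * nr a.
Proof.
move=> K0 hK h; set M := K ^+ 2 + 1.
have M0 : 0 < M by rewrite ltr_wpDl// sqr_ge0.
have eP := @mult_one_unit R A.
pose psi y x := M%:C *: inner y x - phi y x : A.
have psi_cut y x : cuttable y -> nr (psi y x) <= M * (nr y * nr x).
  move=> [p [z [b [zp yE]]]].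
  have zpz := ract_proj_norm zp; have [[sp pp] zzp] := zp.
  (* Replacing b by p b does not change y and gives ||y|| = ||b'||. *)
  have [b' b'E] : exists b', b' = p ** b by eexists.
  have yE' : y = ract z b' by rewrite b'E ractM zpz.
  have pb' : p ** b' = b' by rewrite b'E cmulA pp.
  have nz : nr z <= 1.
    by rewrite -(@ler_pXn2r _ 2)// ?nnegrE ?nr_ge0// expr1n nr_inner zzp
      nr_projection.
  have ny : nr y = nr b'.
    apply/eqP; rewrite -(@eqrXn2 _ 2)// ?nr_ge0//; apply/eqP.
    by rewrite nr_inner yE' inner_ract2 zzp -cmulA pb' nr_starM.
  have [d dE] : exists d, d = phi z z by eexists.
  have psiE : psi y x = star b' ** (M%:C *: p - p ** d ** p) ** inner z x.
    rewrite /psi yE' inner_ractl phi_ractl (phi_proj_normr theta_mod theta_orth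
      x zp) -dE.
    have pd : p ** d ** p = d.
      by rewrite dE -cmulA -phi_ractr zpz -{1}sp -phi_ractl zpz.
    rewrite pd; ncexpand; rewrite -(cmulA _ p) (proj_norm_inner x zp).
    by [].
  rewrite psiE ny mulrA (mulrC M); apply: nrM_le; last first.
    apply: le_trans (cauchy_schwarz _ _) _.
    by rewrite ler_piMl ?nr_ge0.
  apply: nrM_le; first by rewrite nr_star.
  have pd : pos (mult_of d) by rewrite dE; exact: posA_inner.
  have nd : nr d <= M.
    rewrite dE -nr_inner; apply: (@le_trans _ _ (K ^+ 2));
      last by rewrite lerDl.
    rewrite lerXn2r ?nnegrE ?nr_ge0//; apply: le_trans (hK z) _.
    by rewrite ler_piMr.
  rewrite -nr_mult_of.
  have -> : mult_of (M%:C *: p - p ** d ** p) =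
      mult_of p ** (M%:C *: mult_one A - mult_of d) ** mult_of p.
    rewrite mult_of_sub mult_of_scale !mult_of_mul -{1}pp mult_of_mul.
    by ncexpand; rewrite (cmul1r eP).
  rewrite -[M]mulr1 -[X in _ <= X * 1]mul1r.
  have np : nr (mult_of p) <= 1 by rewrite nr_mult_of nr_projection.
  apply: nrM_le => //; apply: nrM_le => //; rewrite mulr1.
  by apply: (pos_near eP) => //; rewrite nr_mult_of.
have psi_le y x : nr (psi y x) <= M * (nr y * nr x).
  have [u [uc uy]] := cuttable_tends A0 y.
  have h1 : tends (fun n => psi (u n) x) (psi y x).
    apply: tendsB; first by apply: tendsZ; exact: tends_innerl.
    apply: tends_innerl; apply: (tends_squeeze (C := K) uy) => n.
    by rewrite -linearB.
  apply/ler_addgt0Pr => r r0.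
  have C1 : 0 < M * nr x + 1 by rewrite ltr_wpDl// mulr_ge0 ?nr_ge0// ltW.
  have [|N hN] := uy (r / 2 / (M * nr x + 1)); first by rewrite !divr_gt0.
  have [|N' hN'] := h1 (r / 2); first by rewrite divr_gt0.
  have := hN _ (leq_maxl N N'); have := hN' _ (leq_maxr N N').
  set n := maxn N N'; rewrite nr_dist => h2; rewrite ltr_pdivlMr// => h3.
  have h4 := nr_le_dist (psi y x) (psi (u n) x).
  have h5 := psi_cut _ x (uc n).
  have h6 : M * nr x * nr (u n) <= M * nr x * (nr y + nr (u n - y)).
    by rewrite ler_wpM2l ?nr_le_dist// mulr_ge0 ?nr_ge0// ltW.
  have := nr_ge0 (u n - y).
  move: h2 h3 h4 h5 h6; move: (nr (u n - y)) (nr (u n)) => s t; lra.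
have bnd b c : image b c -> forall x y,
    nr (inner y x ** (M%:C *: b - c)) <= M * nr b * (nr y * nr x).
  move=> /image_left hbc x y.
  have -> : inner y x ** (M%:C *: b - c) = psi y x ** b.
    by rewrite /psi; ncexpand; rewrite hbc.
  by rewrite mulrAC; apply: nrM_le.
apply: (inner_mul_norm E_full); first by rewrite mulr_ge0 ?nr_ge0// ltW.
- exact: bnd.
- have := bnd _ _ (image_star h); rewrite nr_star starD starN starZr; exact.
Qed.

Lemma exists_multiplier : exists u : multiplier A,
  [/\ mult_central u, mult_positive u &
      forall x y, phi x y = mleft u (inner x y)].
Proof.
have [K K0 hK] := theta_bounded A0 theta_mod theta_orth.
have [L hL] := choice image_exists.
have LE a g : image a g -> L a = g by apply: image_unique; exact: hL.
have L_lin : linear L by move=> k a b; apply: LE; exact: image_lin.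
have L_bnd : bounded_op L.
  apply/bounded_op_real; exists (K ^+ 2); first exact: sqr_ge0.
  by move=> a; apply: image_norm.
have Lr a b : L (a ** b) = L a ** b by apply: LE; exact: imageMr.
have Ll a b : L (a ** b) = a ** L b by apply: LE; exact: imageMl.
have Llr a b : a ** L b = L a ** b by rewrite -Ll Lr.
(* [L] serves as both the left and the right action, from which centrality follows. *)
pose u := Multiplier L_lin L_lin L_bnd L_bnd Lr Ll Llr.
have M0 : 0 < K ^+ 2 + 1 by rewrite ltr_wpDl// sqr_ge0.
have eP := @mult_one_unit R A.
exists u; split.
- move=> v; apply: multiplier_eql => a /=.
  apply/eqP; rewrite -subr_eq0; apply/eqP; apply: cmull_eq0 => b.
  by rewrite cmulDr cmulNr -Ll !mleft_right -Ll subrr.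
- have su : selfadjoint u.
    apply: multiplier_eql => a /=; rewrite -[RHS]starK; congr star.
    exact/LE/image_star.
  have [|b [sb bE _]] := near_pos eP su M0.
    apply: nr_mult_le; first exact: ltW.
    move=> a; rewrite mleft_add mleft_opp mleft_scale.
    by apply: image_pos.
  by exists b; rewrite -bE -{1}sb.
- by move=> x y; apply/esym/LE; exact: image_inner.
Qed.

End Multiplier.

Theorem theorem2p3 (R : realType) (A : cstarAlgType R) (E F : hilbertModType A)
    (theta : {linear E -> F})
    (A_rr0 : real_rank_zero A) (E_full : full E)
    (theta_mod : module_map theta)
    (theta_orth : orthogonality_preserving theta) :
  (exists u : multiplier A,
     [/\ mult_central u, mult_positive u &
         forall x y : E, inner (theta x) (theta y) = mleft u (inner x y)]) /\
  bounded_op theta.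
Proof.
split; first exact: exists_multiplier.
have [K K0 hK] := theta_bounded A_rr0 theta_mod theta_orth.
by apply/bounded_op_real; exists K.
Qed.
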